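(* Let $d\geq 2$ and $\beta>0$. Let $G=(V,E)$ be a subgraph of $\mathbb Z^d$ with $0\in V$. Let $S,B$ be finite subsets of $V$ with $S\cap B=\emptyset$ and $0\in S$. Assume that $\partial S$ separates $0$ and $B$ in the sense that every path from $0$ to $B$ has to visit $\partial S$. Then, $$\phi_{G, \beta}^0[0 \leftrightarrow B] \leq \sum_{\substack{u\in S,\ v\notin S\\ u\sim v}} \phi_{S, \beta}^0[0 \leftrightarrow u]\,\beta\,\phi_{G, \beta}^0[v \leftrightarrow B].$$
   Context: For $x,y\in\mathbb Z^d$, write $x\sim y$ if $|x-y|_2=1$. For $\Lambda\subset\mathbb Z^d$ let $E(\Lambda)=\{xy: x,y\in\Lambda,\ x\sim y\}$, identify $\Lambda$ with the graph $(\Lambda,E(\Lambda))$, and let $\partial\Lambda=\{x\in\Lambda:\exists y\notin\Lambda,\ y\sim x\}$. FK-Ising model with free boundary conditions: for a finite subgraph $G=(V,E)$ of $\mathbb Z^d$ and $\beta\ge0$, $\phi^0_{G,\beta}$ is the probability measure on $\omega\in\{0,1\}^{E}$ proportional to $2^{k(\omega)}\prod_{e\in E}(e^{2\beta}-1)^{\omega_e}$, where $k(\omega)$ is the number of connected components of the graph $(V,\{e\in E:\omega_e=1\})$. For infinite $G$, $\phi^0_{G,\beta}$ is the weak limit of the measures on finite subgraphs increasing to $G$. $x\leftrightarrow A$ means that $x$ is connected to some vertex of $A$ by a path of open edges. Convention: for $v\notin V$ the term $\phi^0_{G,\beta}[v\leftrightarrow B]$ is $0$. *)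

(* Defs.v *)
From HB Require Import structures.
From mathcomp Require Import all_boot all_order all_algebra.
From mathcomp Require Import finmap.
From mathcomp Require Import all_classical all_reals all_analysis.

Set Implicit Arguments.
Unset Strict Implicit.
Unset Printing Implicit Defensive.
Import Order.TTheory GRing.Theory Num.Theory.
Import numFieldNormedType.Exports.
Local Open Scope classical_set_scope.
Local Open Scope ring_scope.

Notation vertex d := 'rV[int]_d.

(* The unoriented edge xy is the finite set [fset x; y]. *)
Notation edge d := {fset 'rV[int]_d}.

(* |x - y|_2 = 1, squared so as to stay in the integers. *)
Definition adj d (x y : vertex d) : bool :=
  \sum_(i < d) (x 0 i - y 0 i) ^+ 2 == 1.

Definition edges_of d (L : set (vertex d)) : set (edge d) :=
  [set e | exists x y, [/\ L x, L y, adj x y & e = [fset x; y]%fset]].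

Record subgraph d := Subgraph {
  gV : set (vertex d);
  gE : set (edge d);
  gE_sub : gE `<=` edges_of gV }.

Definition induced_subgraph d (L : set (vertex d)) : subgraph d :=
  Subgraph (@subset_refl _ (edges_of L)).

Definition boundary d (L : set (vertex d)) : set (vertex d) :=
  [set x | L x /\ exists y, ~ L y /\ adj y x].

Definition graph_adj d (G : subgraph d) : rel (vertex d) :=
  fun x y => [fset x; y]%fset \in gE G.

Definition separates d (G : subgraph d) (X : set (vertex d)) (x : vertex d)
    (B : set (vertex d)) : Prop :=
  forall p : seq (vertex d), path (graph_adj G) x p ->
    B (last x p) -> exists2 z, z \in x :: p & X z.

(* Configurations are indexed by all finite sets of vertices, so that the
   measures of all subgraphs live on one space; a configuration w in {0,1}^E is
   extended by 0 outside E.  The topology is the product topology. *)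
Definition config d : Type := prod_topology (fun _ : edge d => bool).
HB.instance Definition _ d := Topological.on (config d).
HB.instance Definition _ d := Pointed.on (config d).

Definition borel_config d := g_sigma_algebraType (@open (config d)).
HB.instance Definition _ d := Measurable.on (borel_config d).

Definition config_of d (w : {fset edge d}) : config d := fun e => e \in w.

(* The event that x is connected to A by a path of open edges of G; it is empty
   when x is not a vertex of G. *)
Definition connected_to d (G : subgraph d) (x : vertex d)
    (A : set (vertex d)) : set (borel_config d) :=
  [set w | gV G x /\ exists p : seq (vertex d),
    path (fun a b => graph_adj G a b && w [fset a; b]%fset) x p /\
    A (last x p)].

Section FK_finite.
Context (R : realType) (d : nat) (G : subgraph d) (beta : {nonneg R}).

(* [fset_set] is the finite set underlying a finite [set]; the definitions of
   this section are meaningful when [gV G] is finite. *)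
Definition finV : {fset vertex d} := fset_set (gV G).
Definition finE : {fset edge d} := fset_set (gE G).

Definition n_clusters (w : {fset edge d}) : nat :=
  n_comp (fun x y : finV => [fset val x; val y]%fset \in w) predT.

Definition fk_weight (w : {fset edge d}) : R :=
  2 ^+ n_clusters w *
  \prod_(e <- finE) (expR (2 * beta%:num) - 1) ^+ (e \in w).

Definition fk_partition : R := \sum_(w <- fpowerset finE) fk_weight w.

Definition fk_finite (A : set (borel_config d)) : \bar R :=
  (\sum_(w <- fpowerset finE)
     (fk_weight w / fk_partition)%:E * \d_(config_of w : borel_config d) A)%E.

Lemma fk_weight_ge0 w : 0 <= fk_weight w.
Proof.
rewrite /fk_weight mulr_ge0 ?exprn_ge0 //; apply: prodr_ge0 => e _.
by rewrite exprn_ge0 // subr_ge0 -expR0 ler_expR mulr_ge0.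
Qed.

Lemma fk_partition_gt0 : 0 < fk_partition.
Proof.
rewrite /fk_partition (big_fsetD1 fset0) /= ?fpowersetE ?fsub0set //.
rewrite ltr_pwDl ?sumr_ge0 // => [|w _]; last exact: fk_weight_ge0.
by rewrite /fk_weight big1 ?mulr1 ?exprn_gt0 // => e _; rewrite in_fset0 expr0.
Qed.

Lemma fk_mass_ge0 w : 0 <= fk_weight w / fk_partition.
Proof. by rewrite divr_ge0 ?fk_weight_ge0 ?ltW ?fk_partition_gt0. Qed.

Let fk_finite0 : fk_finite set0 = 0%E.
Proof. by rewrite /fk_finite big1 // => w _; rewrite measure0 mule0. Qed.

Let fk_finite_ge0 A : (0 <= fk_finite A)%E.
Proof.
by apply: sume_ge0 => w _; rewrite mule_ge0 // lee_fin fk_mass_ge0.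
Qed.

Let fk_finite_sigma_additive : semi_sigma_additive fk_finite.
Proof.
move=> F mF tF mUF; rewrite [X in _ --> X](_ : _ =
    lim ((fun n => \sum_(0 <= i < n) fk_finite (F i))%E @ \oo)).
  by apply: is_cvg_ereal_nneg_natsum => k _; exact: fk_finite_ge0.
rewrite nneseries_sum; last first.
  by move=> w j _; rewrite mule_ge0 // lee_fin fk_mass_ge0.
apply: eq_bigr => w _; rewrite nneseriesZl //.
by congr (_ * _)%E; exact: measure_semi_bigcup.
Qed.

HB.instance Definition _ := isMeasure.Build _ _ _ fk_finite
  fk_finite0 fk_finite_ge0 fk_finite_sigma_additive.

Let fk_finite_setT : fk_finite setT = 1%E.
Proof.
rewrite /fk_finite; under eq_bigr do rewrite diracT mule1.
by rewrite sumEFin -mulr_suml divff // gt_eqF // fk_partition_gt0.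
Qed.

HB.instance Definition _ :=
  Measure_isProbability.Build _ _ _ fk_finite fk_finite_setT.

End FK_finite.

Definition weak_cvg (R : realType) d
    (P_ : nat -> probability (borel_config d) R)
    (P : probability (borel_config d) R) : Prop :=
  forall f : config d -> R, continuous f -> bounded_fun f ->
    (fun n => \int[P_ n]_w f w)%R @ \oo --> (\int[P]_w f w)%R.

Definition exhaustion d (H : nat -> subgraph d) (G : subgraph d) : Prop :=
  [/\ forall n, finite_set (gV (H n)),
      forall n, gV (H n) `<=` gV (H n.+1) /\ gE (H n) `<=` gE (H n.+1),
      \bigcup_n gV (H n) = gV G & \bigcup_n gE (H n) = gE G].

(* P is the free FK-Ising measure of G.  In infinite volume the limit does not
   depend on the exhaustion, so asking for one exhaustion is enough. *)
Definition is_fk_free (R : realType) d (G : subgraph d) (beta : {nonneg R})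
    (P : probability (borel_config d) R) : Prop :=
  (finite_set (gV G) -> forall A, measurable A -> P A = fk_finite G beta A) /\
  (~ finite_set (gV G) -> exists2 H : nat -> subgraph d, exhaustion H G &
     weak_cvg (fun n => fk_finite (H n) beta) P).

(* Main.v *)
Require Import Defs.
From mathcomp Require Import all_boot all_order all_algebra.
From mathcomp Require Import finmap.
From mathcomp Require Import all_classical all_reals all_analysis.
From mathcomp Require Import ring lra zify.
Import Order.TTheory GRing.Theory Num.Theory.
Import numFieldNormedType.Exports.

(** The FK weight of [w] is, up to a factor depending on the graph only,
    [a ^ #|w|] times the number of even subgraphs of [w], where
    [2 a = exp (2 beta) - 1]; exchanging the two sums turns
    [phi [x <-> y]] into the high temperature expansion of the Ising two-point
    function, with edge weight [t = a / (1 + a) = tanh beta <= beta].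

    If [B] is a single point, the inequality is the Simon-Lieb inequality, which
    follows from the switching lemma: in a pair of subgraphs with sources
    [{0, b}] in [G] and no source in [S], the first subgraph contains a path from
    [0] to [b], which leaves [S] through an edge [uv]; switching along the part of
    the path inside [S] and deleting [uv] produces sources [{v, b}] and [{0, u}].

    For general [B], the points of [B] are explored one after the other: once the
    clusters of the first ones are known and avoid [0], the configuration off
    these clusters is an independent FK configuration on the remaining edges, to
    which the one-point inequality applies, and summing back reconstructs
    [phi [v <-> B]].

    In infinite volume, the FKG inequality makes the finite volume measures
    increase along the exhaustion, so that
    [phi_{H n} [v <-> B in H n] <= phi_G [v <-> B]]. *)

Set Implicit Arguments.
Unset Strict Implicit.
Unset Printing Implicit Defensive.
Local Open Scope fset_scope.
Local Open Scope ring_scope.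

(* The [inE] of [classical_sets] would unfold the boolean [conn] and [src]. *)
Import finmap.

(** * Sums over power sets *)

Section SymmetricDifference.
Context (I : choiceType).
Implicit Types A B C : {fset I}.

Definition symd A B : {fset I} := (A `\` B) `|` (B `\` A).

Lemma in_symd A B x : (x \in symd A B) = (x \in A) (+) (x \in B).
Proof. by rewrite !inE; case: (x \in A); case: (x \in B). Qed.

Lemma symdC A B : symd A B = symd B A.
Proof. by rewrite /symd fsetUC. Qed.

Lemma symdK A : involutive (symd A).
Proof. by move=> B; apply/fsetP => x; rewrite !in_symd addbA addbb. Qed.

Lemma symd_sub A B C : A `<=` C -> B `<=` C -> symd A B `<=` C.
Proof.
move=> /fsubsetP AC /fsubsetP BC; apply/fsubsetP => x; rewrite in_symd.
by have [/AC|_ /BC] := boolP (x \in A).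
Qed.

Lemma odd_card_symd A B : odd #|`symd A B| = odd #|`A| (+) odd #|`B|.
Proof.
have dAB : (A `\` B) `&` (B `\` A) = fset0.
  by apply/fsetP => x; rewrite !inE; case: (x \in A); case: (x \in B).
have := cardfsUI (A `\` B) (B `\` A).
rewrite dAB cardfs0 addn0 -/(symd A B) => ->.
rewrite -(cardfsID B A) -(cardfsID A B) [B `&` A]fsetIC !oddD.
by case: (odd _); case: (odd _); case: (odd _).
Qed.

End SymmetricDifference.

Section PowersetSums.
Context (I : choiceType) (R : pzSemiRingType).
Implicit Types (A B E : {fset I}) (f : {fset I} -> R).

(** Adding a fixed [A] modulo 2 is an involution of the subsets of [E]; this reindexing is what
    moves sources. *)
Lemma sum_powerset_symd A E (P : pred {fset I}) f : A `<=` E ->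
  \sum_(n <- fpowerset E | P n) f n =
  \sum_(n <- fpowerset E | P (symd A n)) f (symd A n).
Proof.
move=> AE; rewrite big_mkcond [RHS]big_mkcond.
transitivity (\sum_(n <- [fset symd A n | n in fpowerset E])
    (if P n then f n else 0)); last first.
  by rewrite big_imfset //= => m n _ _; exact: (can_inj (symdK A)).
apply: eq_fbigl => n; rewrite fpowersetE; apply/idP/imfsetP => /= [nE|[m mE ->]].
  by exists (symd A n); rewrite ?symdK // fpowersetE symd_sub.
by move: mE; rewrite fpowersetE; exact: symd_sub.
Qed.

Lemma sum_powersetU A B f : [disjoint A & B] ->
  \sum_(n <- fpowerset (A `|` B)) f n =
  \sum_(m <- fpowerset A) \sum_(n <- fpowerset B) f (m `|` n).
Proof.
move=> dAB.
transitivity (\sum_(n <- [fset m `|` n | m in fpowerset A, n in fpowerset B])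
    f n); last first.
  rewrite big_imfset2 //=.
  move=> [m n] [m' n'] /=; rewrite !inE /= !fpowersetE.
  move=> /andP[mA nB] /andP[m'A n'B] e.
  have eqI (C D k k' l l' : {fset I}) : [disjoint C & D] ->
      k `<=` C -> k' `<=` C -> l `<=` D -> l' `<=` D -> k `|` l = k' `|` l' ->
      k = k'.
    move=> /fdisjointP dCD /fsubsetP kC /fsubsetP k'C /fsubsetP lD /fsubsetP l'D.
    move=> /fsetP e'; apply/fsetP => x; have := e' x; rewrite !inE.
    have [xC|xC] := boolP (x \in C).
      have xD := dCD _ xC.
      by rewrite (contraNF (lD x)) // (contraNF (l'D x)) // !orbF.
    by rewrite (contraNF (kC x)) // (contraNF (k'C x)).
  have em := eqI _ _ _ _ _ _ dAB mA m'A nB n'B e.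
  have en : n = n'.
    apply: (eqI B A _ _ m m'); rewrite ?(fsetUC n) ?(fsetUC n') //.
    by rewrite fdisjoint_sym.
  by rewrite em en.
apply: eq_fbigl => n; rewrite fpowersetE; apply/idP/imfset2P => /= [nAB|].
  exists (n `&` A); first by rewrite fpowersetE fsubsetIr.
  exists (n `&` B); first by rewrite fpowersetE fsubsetIr.
  by rewrite -fsetIUr (fsetIidPl nAB).
move=> [m]; rewrite fpowersetE => mA [k]; rewrite fpowersetE => kB ->.
exact: fsetUSS.
Qed.

Lemma sum_powersetU1 e E f : e \notin E ->
  \sum_(n <- fpowerset (e |` E)) f n =
  \sum_(n <- fpowerset E) f n + \sum_(n <- fpowerset E) f (e |` n).
Proof.
move=> eE; rewrite sum_powersetU ?fdisjoint1X // fpowerset1.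
rewrite big_fsetU1; last first.
  by rewrite inE; apply/eqP => /fsetP/(_ e); rewrite !inE eqxx.
by rewrite big_seq_fset1; congr (_ + _); apply: eq_bigr => n _; rewrite fset0U.
Qed.

Lemma sum_powerset_superset A E f : A `<=` E ->
  \sum_(n <- fpowerset E | A `<=` n) f n =
  \sum_(n <- fpowerset (E `\` A)) f (A `|` n).
Proof.
move=> AE; have {1}-> : E = A `|` (E `\` A).
  by rewrite -{1}(fsetID A E) (fsetIidPr AE).
rewrite big_mkcond sum_powersetU; last first.
  by apply/fdisjointP => x xA; rewrite !inE xA.
rewrite (big_fsetD1 A) ?fpowersetE //= [X in _ + X]big1_fset ?addr0.
  by apply: eq_bigr => n _; rewrite fsubsetUl.
move=> m; rewrite in_fsetD1 fpowersetE => /andP[mA mE] _.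
apply: big1_fset => n; rewrite fpowersetE => nE _; case: ifP => // Amn.
case/negP: mA; rewrite eqEfsubset mE /=; apply/fsubsetP => x xA.
have /fsubsetP/(_ x xA) := Amn; rewrite inE => /orP[//|/(fsubsetP nE)].
by rewrite !inE xA.
Qed.

Lemma sum_powerset0 f : \sum_(n <- fpowerset fset0) f n = f fset0.
Proof. by rewrite fpowerset0 big_seq_fset1. Qed.

End PowersetSums.

Lemma sum_powerset_binomial (I : choiceType) (R : comPzSemiRingType)
    (E : {fset I}) (a b : R) :
  \sum_(n <- fpowerset E) a ^+ #|`n| * b ^+ #|`E `\` n| = (a + b) ^+ #|`E|.
Proof.
elim/fset1U_rect: E => [|e E eE IH].
  by rewrite sum_powerset0 fsetD0 cardfs0 !expr0 mulr1.
rewrite sum_powersetU1 // cardfsU1 eE exprD expr1 mulrDl -IH addrC !mulr_sumr.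
have ne n : n \in fpowerset E -> e \notin n.
  by rewrite fpowersetE => nE; apply: contraNN eE; exact: (fsubsetP nE).
congr (_ + _); apply: eq_fbigr => n nE _.
  have -> : (e |` E) `\` (e |` n) = E `\` n.
    apply/fsetP => x; rewrite !inE; case: eqP => //= ->.
    by rewrite (negbTE eE) andbF.
  by rewrite cardfsU1 (ne _ nE) exprS mulrA.
have -> : (e |` E) `\` n = e |` (E `\` n).
  by apply/fsetP => x; rewrite !inE; case: eqP => //= ->; rewrite ne.
by rewrite cardfsU1 !inE (negbTE eE) andbF exprS mulrCA.
Qed.

(** * Connectivity and sources *)

Section Connectivity.
Context (T : choiceType).
Implicit Types (w m n E F : {fset {fset T}}) (x y z u v : T) (s : T -> bool).

Definition simple E := forall e, e \in E -> exists x y, x != y /\ e = [fset x; y].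

Lemma simpleS E F : E `<=` F -> simple F -> simple E.
Proof. by move=> /fsubsetP EF sF e /EF/sF. Qed.

Lemma simple_neq E x y : simple E -> [fset x; y] \in E -> x != y.
Proof.
move=> sE /sE[a [b [ab /fsetP e]]]; apply: contraNneq ab => xy.
have := e a; have := e b; rewrite xy !inE !eqxx !orbT !orbb.
by move=> /eqP-> /eqP->.
Qed.

Lemma simple_edge E e x : simple E -> e \in E -> x \in e ->
  exists2 y, x != y & e = [fset x; y].
Proof.
move=> sE /sE[a [b [ab ->]]]; rewrite !inE => /orP[]/eqP->; first by exists b.
by exists a; [rewrite eq_sym | rewrite fsetUC].
Qed.

(** No vertex set is involved: every [x], even on no edge, is connected to itself. *)
Definition conn w x y : bool :=
  `[< exists2 p, path (fun a b => [fset a; b] \in w) x p & last x p = y >].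

Lemma connP w x y :
  reflect (exists2 p, path (fun a b => [fset a; b] \in w) x p & last x p = y)
          (conn w x y).
Proof. exact: asboolP. Qed.

Lemma conn0 w x : conn w x x.
Proof. by apply/connP; exists [::]. Qed.

Lemma conn1 w x y : [fset x; y] \in w -> conn w x y.
Proof. by move=> xy; apply/connP; exists [:: y] => //=; rewrite xy. Qed.

Lemma conn_trans w x y z : conn w x y -> conn w y z -> conn w x z.
Proof.
move=> /connP[p xp <-] /connP[q yq <-]; apply/connP.
by exists (p ++ q); rewrite ?last_cat // cat_path xp.
Qed.

Lemma conn_ind w y (P : T -> Prop) : P y ->
  (forall x z, [fset x; z] \in w -> conn w z y -> P z -> P x) ->
  forall x, conn w x y -> P x.
Proof.
move=> Py step x /connP[p].
elim: p x => [x _ /= -> //|z p IH x /= /andP[xz zp] l].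
by apply: (step x z) => //; [apply/connP; exists p | exact: IH].
Qed.

Lemma conn_sym w x y : conn w x y = conn w y x.
Proof.
suff H a b : conn w a b -> conn w b a by apply/idP/idP; apply: H.
move: a; apply: conn_ind => [|c d cd _ bd]; first exact: conn0.
by apply: conn_trans bd _; rewrite conn1 // fsetUC.
Qed.

Lemma connS w w' x y : w `<=` w' -> conn w x y -> conn w' x y.
Proof.
move=> /fsubsetP ww'; move: x; apply: conn_ind => [|a b /ww' ab _].
  exact: conn0.
exact/conn_trans/conn1.
Qed.

Lemma conn_edge w e x y z : simple w -> e \in w -> x \in e -> y \in e ->
  conn w z x -> conn w z y.
Proof.
move=> sw ew xe ye zx; have [a xa ea] := simple_edge sw ew xe.
move: ye; rewrite ea !inE => /orP[]/eqP-> //.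
by apply: conn_trans zx _; rewrite conn1 // -ea.
Qed.

(** The edge [uv] is the first one by which a path leaves [S]; everything before it runs inside
    [S]. *)
Lemma conn_exit w (S : {fset T}) x y : conn w x y -> x \in S -> y \notin S ->
  exists u v, [/\ u \in S, v \notin S, [fset u; v] \in w &
                  conn [fset e in w | e `<=` S] x u].
Proof.
move: x; apply: conn_ind => [->//|a b ab _ IH aS yS].
have [bS|bS] := boolP (b \in S); last by exists a, b; rewrite conn0.
have [u [v [uS vS uv bu]]] := IH bS yS; exists u, v; split => //.
apply: conn_trans bu; apply: conn1; rewrite !inE ab /=.
by rewrite fsubUset !fsub1set aS.
Qed.

(** The boundary of [n] as a chain modulo 2: the parity of the degree of [z]. *)
Definition bd n z : bool := odd #|` [fset e in n | z \in e]|.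

Lemma bd0 z : bd fset0 z = false.
Proof.
rewrite /bd (_ : [fset _ in _ | _] = fset0) ?cardfs0 //.
by apply/fsetP => e; rewrite !inE.
Qed.

Lemma bd1 e z : bd [fset e] z = (z \in e).
Proof.
rewrite /bd; have [ze|ze] := boolP (z \in e).
  rewrite (_ : [fset _ in _ | _] = [fset e]) ?cardfs1 //.
  by apply/fsetP => f; rewrite !inE; case: eqP => // ->; rewrite ze.
rewrite (_ : [fset _ in _ | _] = fset0) ?cardfs0 //.
by apply/fsetP => f; rewrite !inE; case: eqP => // ->; rewrite (negbTE ze).
Qed.

Lemma bd_symd m n z : bd (symd m n) z = bd m z (+) bd n z.
Proof.
rewrite /bd -odd_card_symd; congr (odd (size (enum_fset _))).
apply/fsetP => e; rewrite in_symd !inE.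
by case: (z \in e); case: (e \in m); case: (e \in n).
Qed.

Definition src n s : bool := `[< bd n =1 s >].

Lemma srcP n s : reflect (bd n =1 s) (src n s).
Proof. exact: asboolP. Qed.

(** Sources are counted modulo 2, so that they cancel when [x = y]. *)
Definition pair x y : T -> bool := fun z => (z == x) (+) (z == y).

Lemma pairxx x : pair x x =1 xpred0.
Proof. by move=> z; rewrite /pair addbb. Qed.

Lemma eq_src n s s' : s =1 s' -> src n s = src n s'.
Proof. by move=> /funext ->. Qed.

Lemma src_symd m n s s' : src m s ->
  src (symd m n) s' = src n (fun z => s z (+) s' z).
Proof.
move=> /srcP ms; apply/srcP/srcP => h z.
  by rewrite -h bd_symd ms addbA addbb.
by rewrite bd_symd ms h addbA addbb.
Qed.

Lemma src_edge x y : x != y -> src [fset [fset x; y]] (pair x y).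
Proof.
move=> xy; apply/srcP => z; rewrite bd1 !inE /pair.
by have [->|//] := eqVneq z x; rewrite (negbTE xy).
Qed.

Lemma pair_trans x y z a : pair x y a (+) pair x z a = pair y z a.
Proof. by rewrite /pair addbACA addbb. Qed.

Lemma src_symd_pair m n x y z : src m (pair x y) ->
  src (symd m n) (pair x z) = src n (pair y z).
Proof.
by move=> /src_symd ->; apply: eq_src => a; rewrite pair_trans.
Qed.

(** Deleting an edge [xz] at the odd vertex [x] moves the source from [x] to [z]; iterating leads to
    [y]. *)
Lemma src_conn n x y : simple n -> src n (pair x y) -> conn n x y.
Proof.
elim/finSet_rect: n x => n IH x sn nxy.
have [->|xy] := eqVneq x y; first exact: conn0.
have [e] : exists e, e \in [fset e in n | x \in e].
  apply/fset0Pn; apply/eqP => e0; have /srcP/(_ x) := nxy.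
  by rewrite /bd e0 cardfs0 /pair eqxx (negbTE xy).
rewrite !inE => /andP[en xe]; have [z xz ez] := simple_edge sn en xe.
have de : symd [fset e] n = n `\ e.
  apply/fsetP => f; rewrite in_symd !inE.
  by case: eqP => //= ->; rewrite en.
apply: (@conn_trans _ _ z); first by rewrite conn1 -?ez.
apply: (connS (fsubD1set n e)); apply: IH; first exact: fproperD1.
  exact: simpleS (fsubD1set n e) sn.
by rewrite -de -(@src_symd_pair [fset e] _ x) ?symdK // ez src_edge.
Qed.

(** The edges of a path, added modulo 2, have its two ends as sources. *)
Lemma conn_src m x y : simple m -> conn m x y ->
  exists2 F, F `<=` m & src F (pair x y).
Proof.
move=> sm; move: x; apply: conn_ind => [|a b ab _ [F Fm Fby]].
  by exists fset0 => //; apply/srcP => z; rewrite bd0 pairxx.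
exists (symd [fset [fset a; b]] F); first by rewrite symd_sub ?fsub1set.
by rewrite (src_symd_pair _ _ (src_edge (simple_neq sm ab))).
Qed.

End Connectivity.

(** * Even subgraphs and the high temperature expansion *)

Section EvenSubgraphs.
Context (T : choiceType) (R : realFieldType).
Implicit Types (w m n E F : {fset {fset T}}) (x y z u v : T) (s : T -> bool).
Implicit Types (a t : R).

(** At [t = tanh beta], the high temperature expansion of the Ising model with sources [s]; at
    [t = 1], a number of subgraphs. *)
Definition gen t E s : R := \sum_(n <- fpowerset E | src n s) t ^+ #|`n|.

Lemma gen_ge0 t E s : 0 <= t -> 0 <= gen t E s.
Proof. by move=> t0; apply: sumr_ge0 => n _; rewrite exprn_ge0. Qed.

Lemma gen_xpred0_ge1 t E : 0 <= t -> 1 <= gen t E xpred0.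
Proof.
move=> t0; rewrite /gen big_mkcond (big_fsetD1 fset0) ?fpowersetE ?fsub0set //.
case: srcP => [_|[]]; last exact: bd0.
rewrite cardfs0 expr0 lerDl sumr_ge0 // => n _.
by case: ifP => // _; rewrite exprn_ge0.
Qed.

(** If [x] and [y] are connected, adding a subgraph with these sources maps even subgraphs
    bijectively onto those with sources [x] and [y]; otherwise there are none of the latter. *)
Lemma gen1_conn w x y : simple w ->
  gen 1 w (pair x y) = gen 1 w xpred0 * (conn w x y)%:R.
Proof.
move=> sw; have [xy|xy] := boolP (conn w x y); last first.
  rewrite mulr0; apply: big1_fset => n; rewrite fpowersetE => nw nxy.
  by case/negP: xy; apply: (connS nw); apply: src_conn nxy; exact: simpleS nw sw.
have [F Fw Fxy] := conn_src sw xy; rewrite mulr1 /gen (sum_powerset_symd _ _ Fw).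
apply: eq_big => n; last by rewrite !expr1n.
by rewrite (src_symd _ _ Fxy); apply: eq_src => z; rewrite addbb.
Qed.

(** An even subgraph using the new edge is, without it, a subgraph of [w] with sources [x] and [y];
    the count doubles exactly when the edge closes a cycle. *)
Lemma gen1U1 w x y : x != y -> simple w -> [fset x; y] \notin w ->
  gen 1 ([fset x; y] |` w) xpred0 = gen 1 w xpred0 * (1 + (conn w x y)%:R).
Proof.
move=> xy sw ew; rewrite mulrDr mulr1 -gen1_conn // /gen.
rewrite ![\sum_(n <- _ | src n _) _]big_mkcond /=.
rewrite sum_powersetU1 //; congr (_ + _); apply: eq_fbigr => n.
rewrite fpowersetE => nw _; rewrite !expr1n.
have -> : [fset x; y] |` n = symd [fset [fset x; y]] n.
  apply/fsetP => f; rewrite in_symd in_fset1U in_fset1.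
  by case: eqP => //= ->; rewrite (contraNN (fsubsetP nw _) ew).
suff -> : src (symd [fset [fset x; y]] n) xpred0 = src n (pair x y) by [].
rewrite (src_symd n xpred0 (src_edge xy)).
by apply: eq_src => z; rewrite addbF.
Qed.

(* A uniform even subgraph of the FK configuration: summing over the
   configuration first leaves the high temperature expansion. *)
Lemma sum_gen1 a E s : 0 <= a ->
  \sum_(w <- fpowerset E) a ^+ #|`w| * gen 1 w s =
  (1 + a) ^+ #|`E| * gen (a / (1 + a)) E s.
Proof.
move=> a0; have a1 : 1 + a != 0 by rewrite gt_eqF // ltr_pwDl.
transitivity (\sum_(w <- fpowerset E) \sum_(n <- fpowerset E | src n s)
    (if n `<=` w then a ^+ #|`w| else 0)).
  apply: eq_fbigr => w; rewrite fpowersetE => wE _; rewrite /gen mulr_sumr.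
  rewrite [LHS]big_mkcond [RHS]big_mkcond /=.
  rewrite -[RHS](@big_fset_incl _ _ _ _ (fpowerset w)) ?fpowersetS // => [|n _].
    apply: eq_fbigr => n; rewrite fpowersetE => nw _.
    by rewrite nw expr1n mulr1.
  by rewrite fpowersetE => /negbTE ->; rewrite if_same.
rewrite exchange_big /= /gen mulr_sumr [LHS]big_seq_cond [RHS]big_seq_cond.
apply: eq_bigr => n /andP[]; rewrite fpowersetE => nE _.
rewrite -big_mkcond /= sum_powerset_superset //.
(* The edges of [E] off [n] are free, each with total weight [a + 1]. *)
transitivity (a ^+ #|`n| * \sum_(m <- fpowerset (E `\` n))
    a ^+ #|`m| * 1 ^+ #|`(E `\` n) `\` m|).
  rewrite mulr_sumr; apply: eq_fbigr => m; rewrite fpowersetE => mE _.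
  rewrite expr1n mulr1 -exprD -cardfsUI (_ : n `&` m = fset0) ?cardfs0 ?addn0 //.
  apply/fsetP => e; rewrite !inE; apply/negbTE/negP => /andP[en /(fsubsetP mE)].
  by rewrite !inE en.
rewrite sum_powerset_binomial -(cardfsID n E) (fsetIidPr nE) exprD expr_div_n.
by rewrite [a + 1]addrC; field; rewrite expf_neq0.
Qed.

End EvenSubgraphs.

(** * The switching lemma *)

Section SimonLieb.
Context (T : choiceType) (R : realFieldType) (t : R).
Hypotheses (t0 : 0 <= t) (t1 : t <= 1).
Implicit Types (E C K n m F : {fset {fset T}}) (S : {fset T}) (x y u v : T).

(* Weight of a pair of subgraphs [n1] and [n2] together with the trace [K] on
   the common edges [C] of a double random current of which [n1] and [n2] are
   the odd parts.  It depends on [n1] and [n2] only through [symd n1 n2], as long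
   as both are open in [K]. *)
Definition switch_weight C K n1 n2 : R :=
  if (n1 `&` C `<=` K) && (n2 `&` C `<=` K) then
    t ^+ #|`symd n1 n2| * (t ^+ 2) ^+ #|`K `\` symd n1 n2| *
    (1 - t ^+ 2) ^+ #|`C `\` K|
  else 0.

Lemma switch_weight_ge0 C K n1 n2 : 0 <= switch_weight C K n1 n2.
Proof.
rewrite /switch_weight; case: ifP => // _.
by rewrite !mulr_ge0 ?exprn_ge0 // subr_ge0 exprn_ile1.
Qed.

(** The edges of [n1] and [n2] in [C] must be open, and any other edge of [C] contributes
    [t ^ 2 + (1 - t ^ 2) = 1]. Each edge common to [n1] and [n2] gets its [t ^ 2] from the second
    factor. *)
Lemma sum_switch_weight E E' n1 n2 : n1 `<=` E -> n2 `<=` E' ->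
  \sum_(K <- fpowerset (E `&` E')) switch_weight (E `&` E') K n1 n2 =
  t ^+ #|`n1| * t ^+ #|`n2|.
Proof.
move=> n1E n2E'; set C := E `&` E'; pose A := (n1 `|` n2) `&` C.
have n12C : n1 `&` n2 `<=` C by rewrite fsetISS.
have AC : A `<=` C by exact: fsubsetIr.
under eq_bigr do rewrite /switch_weight -fsubUset -fsetIUl -/A.
rewrite -big_mkcond /= sum_powerset_superset //.
have cU : (#|`symd n1 n2| + #|`n1 `&` n2| = #|`n1 `|` n2|)%N.
  have -> : n1 `|` n2 = symd n1 n2 `|` (n1 `&` n2).
    apply/fsetP => e; rewrite [in RHS]in_fsetU in_symd !inE.
    by case: (e \in n1); case: (e \in n2).
  rewrite -cardfsUI (_ : symd n1 n2 `&` _ = fset0) ?cardfs0 ?addn0 //.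
  apply/fsetP => e; rewrite in_fsetI in_symd !inE.
  by case: (e \in n1); case: (e \in n2).
transitivity (t ^+ #|`n1| * t ^+ #|`n2| * \sum_(K <- fpowerset (C `\` A))
    (t ^+ 2) ^+ #|`K| * (1 - t ^+ 2) ^+ #|`(C `\` A) `\` K|); last first.
  by rewrite sum_powerset_binomial subrKC expr1n mulr1.
rewrite mulr_sumr; apply: eq_fbigr => K; rewrite fpowersetE => KC _.
have KCA e : e \in K -> [&& e \notin n1, e \notin n2 & e \in C].
  by move=> /(fsubsetP KC); rewrite !inE; case: (e \in n1); case: (e \in n2);
    case: (e \in E); case: (e \in E').
rewrite mulrA; congr (_ * _); last by rewrite fsetDDl.
have -> : (A `|` K) `\` symd n1 n2 = (n1 `&` n2) `|` K.
  apply/fsetP => e; rewrite in_fsetD in_symd in_fsetU in_fsetI !in_fsetU in_fsetI.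
  have [/KCA/and3P[/negbTE-> /negbTE->]//|_] := boolP (e \in K).
  have := fsubsetP n12C e; rewrite in_fsetI.
  by case: (e \in n1); case: (e \in n2) => //= ->.
rewrite -!exprM -!exprD -[X in _ = t ^+ (X + _)]cardfsUI -cU; congr (t ^+ _).
have := cardfsUI (n1 `&` n2) K; rewrite (_ : _ `&` K = fset0) ?cardfs0 ?addn0.
  by move=> ->; ring.
apply/fsetP => e; rewrite in_fset0 !in_fsetI; apply/negP => /andP[/andP[e1 _]].
by move=> /KCA; rewrite e1.
Qed.

(** Adding [F] to both subgraphs preserves their symmetric difference, and also their openness
    because [F] lies in [K]; the edge [f], off [C], costs one factor [t]. *)
Lemma switch_weight_symd C K F n1 n2 f : F `<=` K -> K `<=` C ->
  f \notin C -> f \notin n1 -> f \notin n2 ->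
  switch_weight C K (symd (symd [fset f] F) n1) (symd F n2) =
  t * switch_weight C K n1 n2.
Proof.
move=> FK KC fC fn1 fn2.
have e1 : (symd (symd [fset f] F) n1 `&` C `<=` K) = (n1 `&` C `<=` K).
  apply/fsubsetP/fsubsetP => h e; have := h e;
  rewrite !in_fsetI !in_symd in_fset1; have := fsubsetP FK e;
  have [->|_] := eqVneq e f; rewrite ?(negbTE fC) ?andbF //=;
  by case: (e \in F) => //= /(_ isT) ->.
have e2 : (symd F n2 `&` C `<=` K) = (n2 `&` C `<=` K).
  apply/fsubsetP/fsubsetP => h e; have := h e; rewrite !in_fsetI !in_symd;
  by have := fsubsetP FK e; case: (e \in F) => //= /(_ isT) ->.
rewrite /switch_weight e1 e2; case: ifP; rewrite ?mulr0 // => _.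
have fF : f \notin F by apply: contra fC => /(fsubsetP FK)/(fsubsetP KC).
have fK : f \notin K by apply: contra fC => /(fsubsetP KC).
have -> : symd (symd (symd [fset f] F) n1) (symd F n2) = f |` symd n1 n2.
  apply/fsetP => e; rewrite in_fset1U !in_symd in_fset1.
  have [->|_] := eqVneq e f.
    by rewrite (negbTE fF) (negbTE fn1) (negbTE fn2).
  by case: (e \in F); case: (e \in n1); case: (e \in n2).
rewrite cardfsU1 in_symd (negbTE fn1) (negbTE fn2) exprD expr1 !mulrA.
suff -> : K `\` (f |` symd n1 n2) = K `\` symd n1 n2 by [].
apply/fsetP => e; rewrite !in_fsetD in_fset1U.
by have [->|] := eqVneq e f; rewrite ?(negbTE fK) ?andbF.
Qed.

(** Some [F] in [K] has sources [x] and [u]. Adding [F] and [uv] to the first subgraph and [F] to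
    the second turns the sources of one side into those of the other; the first subgraph loses [uv],
    hence the factor [t]. *)
Lemma switching E E' K x y u v : simple E -> K `<=` E `&` E' ->
  conn K x u -> [fset u; v] \in E -> [fset u; v] \notin E' ->
  \sum_(n1 <- fpowerset E | src n1 (pair x y))
    \sum_(n2 <- fpowerset E' | src n2 xpred0)
      (if [fset u; v] \in n1 then switch_weight (E `&` E') K n1 n2 else 0) <=
  \sum_(n1 <- fpowerset E | src n1 (pair v y))
    \sum_(n2 <- fpowerset E' | src n2 (pair x u))
      t * switch_weight (E `&` E') K n1 n2.
Proof.
move=> sE KC xu fE fE'; set f := [fset u; v] in fE fE' *.
have uv : u != v := simple_neq sE fE.
have KE : K `<=` E := fsubset_trans KC (fsubsetIl _ _).
have KE' : K `<=` E' := fsubset_trans KC (fsubsetIr _ _).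
have [F FK Fxu] := conn_src (simpleS KE sE) xu.
have F1E : symd [fset f] F `<=` E.
  by rewrite symd_sub ?fsub1set // (fsubset_trans FK).
have F2E : F `<=` E' := fsubset_trans FK KE'.
have F1 : src (symd [fset f] F) (pair x v).
  rewrite symdC (src_symd_pair _ _ Fxu); exact: src_edge.
rewrite [leLHS](sum_powerset_symd _ _ F1E) big_seq_cond [X in _ <= X]big_seq_cond.
rewrite (eq_bigl (fun n1 => (n1 \in fpowerset E) && src n1 (pair v y)));
  last by move=> n1; rewrite (src_symd_pair _ _ F1).
apply: ler_sum => n1 /andP[]; rewrite fpowersetE => n1E _.
rewrite [leLHS](sum_powerset_symd _ _ F2E) big_seq_cond [X in _ <= X]big_seq_cond.
rewrite (eq_bigl (fun n2 => (n2 \in fpowerset E') && src n2 (pair x u)));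
  last first.
  move=> n2; rewrite (src_symd _ _ Fxu); congr (_ && _).
  by apply: eq_src => z; rewrite addbF.
apply: ler_sum => n2 /andP[]; rewrite fpowersetE => n2E _.
have fC : f \notin E `&` E' by rewrite in_fsetI negb_and fE' orbT.
have fF : f \notin F.
  by apply: contra fE' => /(fsubsetP F2E).
have fn2 : f \notin n2 by apply: contra fE' => /(fsubsetP n2E).
rewrite !in_symd in_fset1 eqxx (negbTE fF) /=.
(* If the reindexed [n1] contains [f], the original one does not, and the term appears on the right
   only. *)
have [fn1|fn1] /= := boolP (f \in n1); last by rewrite switch_weight_symd.
by rewrite mulr_ge0 ?switch_weight_ge0.
Qed.

(* The path of the odd part [n1] from [x] to [y] leaves [S] through an edge [uv]
   after having stayed inside [S]; switching along this first part turns the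
   sources [xy] and [0] into [uy] and [xu], and then [uv] is removed. *)
Theorem simon_lieb E E' S x y (D : {fset T * T}) : simple E ->
  (forall e, e \in E' -> e `<=` S) ->
  (forall e, e \in E -> e `<=` S -> e \in E') ->
  x \in S -> y \notin S ->
  (forall u v, u \in S -> v \notin S -> [fset u; v] \in E -> (u, v) \in D) ->
  gen t E (pair x y) * gen t E' xpred0 <=
  \sum_(uv <- D) t * gen t E' (pair x uv.1) * gen t E (pair uv.2 y).
Proof.
move=> sE E'S ES xS yS ED; pose W := switch_weight (E `&` E').
have prodE s s' : gen t E s * gen t E' s' =
    \sum_(K <- fpowerset (E `&` E')) \sum_(n1 <- fpowerset E | src n1 s)
      \sum_(n2 <- fpowerset E' | src n2 s') W K n1 n2.
  rewrite exchange_big /= /gen mulr_suml [LHS]big_seq_cond [RHS]big_seq_cond.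
  apply: eq_bigr => n1 /andP[]; rewrite fpowersetE => n1E _.
  rewrite exchange_big /= mulr_sumr [LHS]big_seq_cond [RHS]big_seq_cond.
  apply: eq_bigr => n2 /andP[]; rewrite fpowersetE => n2E _.
  by rewrite sum_switch_weight.
rewrite prodE; under [leRHS]eq_bigr => uv _ do
  rewrite mulrAC -mulrA prodE mulr_sumr.
rewrite [leRHS]exchange_big /= big_seq_cond [leRHS]big_seq_cond.
apply: ler_sum => K /andP[]; rewrite fpowersetE => KC _.
(* Only the terms to which [switching] applies are kept. *)
pose H uv n1 n2 := if [&& conn K x uv.1, [fset uv.1; uv.2] \in E,
    [fset uv.1; uv.2] \notin E' & [fset uv.1; uv.2] \in n1]
  then W K n1 n2 else 0.
have H0 uv n1 n2 : 0 <= H uv n1 n2.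
  by rewrite /H; case: ifP => // _; exact: switch_weight_ge0.
apply: (@le_trans _ _ (\sum_(n1 <- fpowerset E | src n1 (pair x y))
    \sum_(n2 <- fpowerset E' | src n2 xpred0) \sum_(uv <- D) H uv n1 n2)).
  rewrite big_seq_cond [leRHS]big_seq_cond.
  apply: ler_sum => n1 /andP[]; rewrite fpowersetE => n1E n1xy.
  apply: ler_sum => n2 _; rewrite /W /switch_weight.
  case: ifPn => [/andP[n1K n2K]|_]; last by rewrite sumr_ge0.
  have [u [v [uS vS uv xu]]] :=
    conn_exit (src_conn (simpleS n1E sE) n1xy) xS yS.
  have uvE : [fset u; v] \in E := fsubsetP n1E _ uv.
  rewrite (big_fsetD1 (u, v)) /=; last exact: ED.
  (* The first part of the path is open in [K]: its edges belong to [n1] and lie inside [S], so they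
     are common to [E] and [E']. *)
  rewrite {1}/H /= uv uvE (connS _ xu) /=; last first.
    apply/fsubsetP => e; rewrite !inE => /andP[en eS]; apply: (fsubsetP n1K).
    have eE := fsubsetP n1E _ en.
    by rewrite !inE en eE ES.
  have -> /= : [fset u; v] \notin E'.
    by apply: contra vS => /E'S /fsubsetP; apply; rewrite !inE eqxx orbT.
  by rewrite /W /switch_weight n1K n2K lerDl sumr_ge0.
under [leLHS]eq_bigr do rewrite exchange_big /=.
rewrite [leLHS]exchange_big /=; apply: ler_sum => -[u v] _ /=.
have [/and3P[xu uvE uvE']|nuv] :=
  boolP [&& conn K x u, [fset u; v] \in E & [fset u; v] \notin E'].
  apply: le_trans (le_trans (switching y sE KC xu uvE uvE') _).
    by rewrite /H /= xu uvE uvE'.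
  by rewrite mulr_sumr ler_sum // => n1 _; rewrite mulr_sumr.
rewrite big1; last first.
  move=> n1 _; rewrite big1 // => n2 _; rewrite /H /=.
  by move: nuv; case: conn; case: (_ \in E) => //; case: (_ \in E').
rewrite mulr_ge0 //; apply: sumr_ge0 => n1 _; apply: sumr_ge0 => n2 _.
exact: switch_weight_ge0.
Qed.

End SimonLieb.

(** * Exploration of clusters *)

Section Exploration.
Context (T : choiceType) (R : realFieldType).
Implicit Types (w E n m : {fset {fset T}}) (B S : {fset T}) (x y z u v b : T).
Implicit Types (a : R).

(* Proportional, for configurations on a fixed graph, to the FK weight
   [2 ^ k(w) * (2 * a) ^ #|w|]. *)
Definition wt a w : R := a ^+ #|`w| * gen 1 w xpred0.

Lemma wt_ge0 a w : 0 <= a -> 0 <= wt a w.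
Proof. by move=> a0; rewrite mulr_ge0 ?exprn_ge0 ?gen_ge0. Qed.

Definition hit w v B : bool := has (conn w v) B.

Lemma hitP w v B : reflect (exists2 y, y \in B & conn w v y) (hit w v B).
Proof. exact: hasP. Qed.

Definition hit_weight a E v B : R := \sum_(w <- fpowerset E | hit w v B) wt a w.

Lemma hit_weight_ge0 a E v B : 0 <= a -> 0 <= hit_weight a E v B.
Proof. by move=> a0; apply: sumr_ge0 => w _; exact: wt_ge0. Qed.

Lemma hit_weight1 a E v y : 0 <= a -> simple E ->
  hit_weight a E v [fset y] =
  (1 + a) ^+ #|`E| * gen (a / (1 + a)) E (pair v y).
Proof.
move=> a0 sE; rewrite -sum_gen1 // /hit_weight big_mkcond /=.
apply: eq_fbigr => w; rewrite fpowersetE => wE _.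
rewrite gen1_conn; last exact: simpleS wE sE.
have -> : hit w v [fset y] = conn w v y.
  by apply/hitP/idP => [[z /fset1P ->]//|]; exists y; rewrite ?inE.
by rewrite /wt mulrA; case: conn; rewrite ?mulr1 ?mulr0.
Qed.

Definition cluster w b := [fset e in w | has (conn w b) (e : {fset T})].

(** The edges left undetermined by the exploration of the cluster of [b]: an edge touching the
    cluster is either in it or closed. *)
Definition outside E w b := [fset e in E | ~~ has (conn w b) (e : {fset T})].

Lemma in_cluster w b e : (e \in cluster w b) = (e \in w) && has (conn w b) e.
Proof. by rewrite !inE. Qed.

Lemma in_outside E w b e :
  (e \in outside E w b) = (e \in E) && ~~ has (conn w b) e.
Proof. by rewrite !inE. Qed.

Lemma cluster_sub w b : cluster w b `<=` w.
Proof. by apply/fsubsetP => e; rewrite in_cluster => /andP[]. Qed.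

Lemma outside_sub E w b : outside E w b `<=` E.
Proof. by apply/fsubsetP => e; rewrite in_outside => /andP[]. Qed.

Lemma conn_cluster w b x : conn (cluster w b) b x = conn w b x.
Proof.
apply/idP/idP; first exact/connS/cluster_sub.
rewrite !(conn_sym _ b); move: x; apply: conn_ind => [|x z xz zb IH].
  exact: conn0.
apply: conn_trans IH; apply: conn1; rewrite in_cluster xz /=.
by apply/hasP; exists z; rewrite ?inE ?eqxx ?orbT // conn_sym.
Qed.

Lemma cluster_id w b : cluster (cluster w b) b = cluster w b.
Proof.
apply/fsetP => e; rewrite [LHS]in_cluster; apply: andb_idr => ew.
by rewrite (eq_has (conn_cluster w b)); move: ew; rewrite in_cluster => /andP[].
Qed.

(** * Configurations with a given cluster *)

Section Glue.
Variables (E w w' : {fset {fset T}}) (b : T).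
Hypotheses (sE : simple E) (wE : w `<=` E) (wb : cluster w b = w).
Hypothesis w'E : w' `<=` outside E w b.

Let sw : simple w. Proof. exact: simpleS wE sE. Qed.

Lemma cluster_conn e z : e \in w -> z \in e -> conn w b z.
Proof.
move=> ew ze; have := ew; rewrite -{1}wb in_cluster => /andP[_ /hasP[y ye by_]].
exact: conn_edge sw ew ye ze by_.
Qed.

Lemma outside_not_conn e z : e \in w' -> z \in e -> ~~ conn w b z.
Proof.
move=> /(fsubsetP w'E); rewrite in_outside => /andP[_ /hasPn h]; exact: h.
Qed.

Lemma glue_conn x : conn (w `|` w') b x = conn w b x.
Proof.
apply/idP/idP; last exact/connS/fsubsetUl.
rewrite !(conn_sym _ b); move: x; apply: conn_ind => [|x z xz _ IH].
  exact: conn0.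
have [xw|xw'] := fsetUP _ _ _ xz; first exact: conn_trans (conn1 xw) IH.
have /negP[] := outside_not_conn xw' (fset22 x z); by rewrite conn_sym.
Qed.

Lemma glue_cluster : cluster (w `|` w') b = w.
Proof.
apply/fsetP => e; rewrite in_cluster in_fsetU (eq_has glue_conn).
have [ew|ew] /= := boolP (e \in w).
  by move: ew; rewrite -{1}wb in_cluster => /andP[].
by apply/negP => /andP[/(fsubsetP w'E)]; rewrite in_outside => /andP[_ /negbTE->].
Qed.

Lemma glue_disjoint : [disjoint w & w'].
Proof.
apply/fdisjointP => e ew; apply/negP => /(fsubsetP w'E); rewrite in_outside.
by move: ew; rewrite -{1}wb in_cluster => /andP[_ ->]; rewrite andbF.
Qed.

Lemma bd_mem n z : bd n z -> exists2 e, e \in n & z \in e.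
Proof.
rewrite /bd; have [->|[e]] := fset_0Vmem [fset e in n | z \in (e : {fset T})].
  by rewrite cardfs0.
by rewrite !inE => /andP[en ze] _; exists e.
Qed.

(** No vertex lies both on an edge of [w] and on an edge of [w'], so the two degree conditions do
    not interact. *)
Lemma glue_src m n : m `<=` w -> n `<=` w' ->
  src (m `|` n) xpred0 = src m xpred0 && src n xpred0.
Proof.
move=> mw nw'.
have -> : m `|` n = symd m n.
  apply/fsetP => e; rewrite in_symd in_fsetU.
  have := fdisjointP glue_disjoint e; have := fsubsetP mw e.
  have := fsubsetP nw' e; case: (e \in m) => //=; case: (e \in n) => //=.
  by move=> /(_ isT) -> /(_ isT) -> /(_ isT).
have mz z : bd m z -> conn w b z.
  by move=> /bd_mem[e /(fsubsetP mw)]; exact: cluster_conn.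
have nz z : bd n z -> ~~ conn w b z.
  by move=> /bd_mem[e /(fsubsetP nw')]; exact: outside_not_conn.
apply/srcP/andP => [h|[/srcP hm /srcP hn] z]; last by rewrite bd_symd hm hn.
by split; apply/srcP => z; have := h z; rewrite bd_symd; have := mz z;
  have := nz z; case: (bd m z); case: (bd n z) => //= /(_ isT)/negP nc /(_ isT).
Qed.

(** Even subgraphs of the union are unions of even subgraphs of the two parts. This factorisation
    makes the configuration off the cluster an independent FK configuration. *)
Lemma glue_wt a : wt a (w `|` w') = wt a w * wt a w'.
Proof.
rewrite /wt mulrACA -exprD -cardfsUI.
have -> : w `&` w' = fset0 by apply/eqP; rewrite fsetI_eq0; exact: glue_disjoint.
rewrite cardfs0 addn0; congr (_ * _).
rewrite /gen [LHS]big_mkcond sum_powersetU ?glue_disjoint //.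
rewrite mulr_suml [RHS]big_mkcond /=; apply: eq_fbigr => m.
rewrite fpowersetE => mw _; rewrite mulr_sumr.
case: ifP => ms; last first.
  by apply: big1_fset => n; rewrite fpowersetE => nw' _; rewrite glue_src // ms.
rewrite [RHS]big_mkcond /=; apply: eq_fbigr => n.
by rewrite fpowersetE => nw' _; rewrite glue_src // ms /= !expr1n mulr1.
Qed.

(** A path from [v] avoiding the cluster of [b] uses [w'] only. If [v] is in the cluster, both sides
    fail: [w'] has no edge at [v], and [v] is not in the reduced target. *)
Lemma glue_hit v B :
  hit (w `|` w') v B && ~~ conn (w `|` w') b v =
  hit w' v [fset y in B | ~~ conn w b y].
Proof.
apply/andP/hitP => [[/hitP[y yB vy] bv]|[y]].
  have by_ : ~~ conn (w `|` w') b y.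
    by apply: contra bv => /conn_trans; apply; rewrite conn_sym.
  exists y; first by rewrite !inE yB -glue_conn.
  move: v vy {bv}; apply: conn_ind => [|x z xz zy IH]; first exact: conn0.
  have [xw|xw'] := fsetUP _ _ _ xz; last exact: conn_trans (conn1 xw') IH.
  have := cluster_conn xw (fset22 x z).
  by rewrite -glue_conn => /conn_trans/(_ zy); rewrite (negbTE by_).
rewrite !inE => /andP[yB by_] vy.
have vy' : conn (w `|` w') v y by apply: connS vy; exact: fsubsetUr.
split; first by apply/hitP; exists y.
by apply: contra by_ => bv; rewrite -glue_conn; exact: conn_trans bv vy'.
Qed.

End Glue.

(** A configuration is determined by the cluster of [b] and by its edges away from this cluster,
    which are arbitrary. *)
Lemma sum_cluster E b (f : {fset {fset T}} -> R) : simple E ->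
  \sum_(w <- fpowerset E) f w =
  \sum_(w <- fpowerset E | cluster w b == w)
    \sum_(w' <- fpowerset (outside E w b)) f (w `|` w').
Proof.
move=> sE; transitivity (\sum_(w <- fpowerset E) \sum_(k <- fpowerset E)
    (if cluster w b == k then f w else 0)).
  apply: eq_fbigr => w wE _; rewrite (big_fsetD1 (cluster w b)) /=; last first.
    by move: wE; rewrite !fpowersetE; apply: fsubset_trans; exact: cluster_sub.
  rewrite eqxx [X in _ + X]big1_fset ?addr0 // => k; rewrite in_fsetD1.
  by rewrite eq_sym => /andP[/negbTE->].
rewrite exchange_big /= [RHS]big_mkcond /=; apply: eq_fbigr => k.
rewrite fpowersetE => kE _; case: eqP => kb; last first.
  by apply: big1 => w _; case: eqP => // wk; case: kb; rewrite -wk cluster_id.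
rewrite -big_mkcond /= big_fset_condE.
transitivity (\sum_(w <- [fset k `|` w' | w' in fpowerset (outside E k b)]) f w).
  apply: eq_fbigl => w; rewrite !inE fpowersetE /=.
  apply/andP/imfsetP => /= [[wE /eqP wk]|[w']].
    exists (w `\` k).
      rewrite fpowersetE; apply/fsubsetP => e; rewrite in_fsetD -{1}wk in_cluster.
      rewrite in_outside => /andP[+ ew]; rewrite ew (fsubsetP wE) //=.
      by rewrite -wk (eq_has (conn_cluster w b)).
    by rewrite fsetUC fsetUDr fsetDv fsetD0 (fsetUidPl _ _ _) // -wk cluster_sub.
  rewrite fpowersetE => w'E ->; rewrite (glue_cluster kb w'E) //.
  by split=> //; rewrite fsubUset kE (fsubset_trans w'E (outside_sub E k b)).
rewrite big_imfset //= => m n; rewrite !fpowersetE => mE nE e.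
apply/fsetP => i; have /fsetP/(_ i) := e; rewrite !in_fsetU.
have := fdisjointP (glue_disjoint kb mE) i.
have := fdisjointP (glue_disjoint kb nE) i.
by case: (i \in k) => //= /(_ isT)/negbTE-> /(_ isT)/negbTE->.
Qed.

(** When [v] is not connected to [b], the cluster [w] of [b] is fixed first; the other edges must
    then connect [v] to a point of [B] off this cluster. *)
Lemma hit_weightU1 a E v b B : 0 <= a -> simple E -> b \in B ->
  hit_weight a E v B = hit_weight a E v [fset b] +
  \sum_(w <- fpowerset E | cluster w b == w)
    wt a w * hit_weight a (outside E w b) v [fset y in B | ~~ conn w b y].
Proof.
move=> a0 sE bB; rewrite /hit_weight.
transitivity (\sum_(w <- fpowerset E | hit w v [fset b]) wt a w +
  \sum_(w <- fpowerset E) (if hit w v B && ~~ conn w b v then wt a w else 0)).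
  rewrite [X in X + _]big_mkcond [LHS]big_mkcond -big_split /=.
  apply: eq_bigr => w _; have -> : hit w v [fset b] = conn w b v.
    rewrite conn_sym; apply/hitP/idP => [[z /fset1P ->]//|].
    by exists b; rewrite ?inE.
  have [bv|] := boolP (conn w b v); last by rewrite andbT add0r.
  rewrite andbF addr0; case: ifPn => // /hitP[].
  by exists b; rewrite // conn_sym.
congr (_ + _); rewrite (sum_cluster b _ sE) big_seq_cond [RHS]big_seq_cond.
apply: eq_bigr => w /andP[]; rewrite fpowersetE => wE /eqP wb.
rewrite mulr_sumr [RHS]big_mkcond /=; apply: eq_fbigr => w'.
rewrite fpowersetE => w'E _.
by rewrite (glue_hit sE wE wb w'E) (glue_wt sE wE wb w'E).
Qed.

(* The points of [B] are explored one at a time: once the cluster of [b] is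
   known not to contain [x], the rest of the configuration is an independent
   FK configuration on the edges away from that cluster. *)
Theorem simon_lieb_hit a E E' S x B (D : {fset T * T}) :
  0 <= a -> simple E ->
  (forall e, e \in E' -> e `<=` S) ->
  (forall e, e \in E -> e `<=` S -> e \in E') ->
  x \in S -> [disjoint S & B] ->
  (forall u v, u \in S -> v \notin S -> [fset u; v] \in E -> (u, v) \in D) ->
  hit_weight a E x B <=
  \sum_(uv <- D)
    gen (a / (1 + a)) E' (pair x uv.1) / gen (a / (1 + a)) E' xpred0 *
    (a / (1 + a)) * hit_weight a E uv.2 B.
Proof.
set t := a / (1 + a); move=> a0 + E'S + xS.
have a1 : 0 < 1 + a by rewrite ltr_pwDl.
have t0 : 0 <= t by rewrite divr_ge0 // ltW.
have t1 : t <= 1 by rewrite ler_pdivrMr // mul1r lerDr.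
have Z0 : 0 < gen t E' xpred0 by rewrite (lt_le_trans ltr01) ?gen_xpred0_ge1.
(* [B] and [E] shrink together while [E'] stays fixed; the hypotheses on [E] pass to its subsets. *)
elim/finSet_rect: B E => B IH E sE ES SB ED.
have [B0|[b bB]] := fset_0Vmem B.
  rewrite {1}/hit_weight big1 => [|w /hitP[y]]; last by rewrite B0.
  apply: sumr_ge0 => uv _.
  by rewrite !mulr_ge0 ?invr_ge0 ?hit_weight_ge0 ?gen_ge0 // ltW.
under [leRHS]eq_bigr do rewrite (hit_weightU1 _ a0 sE bB) mulrDr mulr_sumr.
rewrite (hit_weightU1 _ a0 sE bB) big_split /= lerD //.
  (* For the single target [b], this is [simon_lieb] up to the factor [(1 + a) ^ #|E|]. *)
  have bS : b \notin S by apply/negP => /(fdisjointP SB); rewrite bB.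
  under eq_bigr do rewrite hit_weight1 //; rewrite hit_weight1 //.
  rewrite -ler_pdivlMl ?exprn_gt0 // -(ler_pM2r Z0).
  apply: le_trans (simon_lieb t0 t1 sE E'S ES xS bS ED) _.
  rewrite mulrAC mulr_sumr ler_sum // => uv _; rewrite le_eqVlt; apply/orP; left.
  apply/eqP; field; rewrite ?gt_eqF ?exprn_gt0 //.
(* For each cluster [w] of [b], the induction hypothesis is applied to the edges outside [w] and to
   the points of [B] off it. *)
rewrite exchange_big /= big_seq_cond [leRHS]big_seq_cond.
apply: ler_sum => w /andP[]; rewrite fpowersetE => wE /eqP wb.
under eq_bigr do rewrite mulrCA; rewrite -mulr_sumr ler_wpM2l ?wt_ge0 //.
have BwB : [fset y in B | ~~ conn w b y] `<=` B by exact: fset_sub.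
have oE := fsubsetP (outside_sub E w b).
apply: IH => [||e /oE||u v uS vS /oE].
- rewrite fproperE BwB /=; apply/negP => /fsubsetP/(_ b bB).
  by rewrite !inE conn0 andbF.
- exact: simpleS (outside_sub E w b) sE.
- exact: ES.
- exact: fdisjointWr BwB SB.
- exact: ED.
Qed.

End Exploration.

(** * The FKG inequality *)

Section FKG.
Context (R : realFieldType).

Definition increasing_on (I : choiceType) (E : {fset I}) (g : {fset I} -> R) :=
  forall w w', w `<=` w' -> w' `<=` E -> g w <= g w'.

(** The condition on [f] says that the odds of opening an edge increase with the rest of the
    configuration. The proof is by induction on [E], conditioning on the state of one edge. *)
Lemma FKG (I : choiceType) (E : {fset I}) (f g h : {fset I} -> R) :
  (forall w, w `<=` E -> 0 < f w) ->
  (forall e w w', e \in E -> w `<=` w' -> w' `<=` E -> e \notin w' ->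
     f (e |` w) * f w' <= f w * f (e |` w')) ->
  increasing_on E g -> increasing_on E h ->
  (\sum_(w <- fpowerset E) f w * g w) * (\sum_(w <- fpowerset E) f w * h w) <=
  (\sum_(w <- fpowerset E) f w) * (\sum_(w <- fpowerset E) f w * (g w * h w)).
Proof.
elim/fset1U_rect: E f g h => [|e E eE IH] f g h f0 fE gE hE.
  by rewrite !sum_powerset0 le_eqVlt; apply/orP; left; apply/eqP; ring.
have eS w : w `<=` E -> w `<=` e |` E.
  by move/fsubset_trans; apply; exact: fsubsetUr.
have eU w w' : w `<=` w' -> e |` w `<=` e |` w' by exact: fsetUS.
have f0' w : w `<=` E -> 0 < f w by move=> /eS; exact: f0.
have f1' w : w `<=` E -> 0 < f (e |` w) by move=> /eU; exact: f0.
have up g' : increasing_on (e |` E) g' -> increasing_on E g' /\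
    increasing_on E (fun w => g' (e |` w)).
  by move=> g'E; split => w w' ww' w'E; apply: g'E; rewrite ?eU ?eS.
have [[g0 g1] [h0 h1]] := (up g gE, up h hE).
have fE0 e' w w' : e' \in E -> w `<=` w' -> w' `<=` E -> e' \notin w' ->
    f (e' |` w) * f w' <= f w * f (e' |` w').
  by move=> e'E ww' w'E e'w'; apply: fE; rewrite ?eS // !inE e'E orbT.
have fE1 e' w w' : e' \in E -> w `<=` w' -> w' `<=` E -> e' \notin w' ->
    f (e |` (e' |` w)) * f (e |` w') <= f (e |` w) * f (e |` (e' |` w')).
  move=> e'E ww' w'E e'w'; rewrite !(fsetUCA [fset e]); apply: fE; rewrite ?eU //.
    by rewrite !inE e'E orbT.
  by rewrite !inE negb_or e'w' andbT; apply: contraNneq eE => <-.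
have pos f' : (forall w, w `<=` E -> 0 < f' w) ->
    0 < \sum_(w <- fpowerset E) f' w :> R.
  move=> f'0; rewrite (big_fsetD1 fset0) ?fpowersetE ?fsub0set //=.
  rewrite ltr_pwDl ?f'0 ?fsub0set // big_seq_cond sumr_ge0 // => w.
  by rewrite andbT in_fsetD1 fpowersetE => /andP[_ wE]; rewrite ltW ?f'0.
(* The mean of [g'] is larger when [e] is open: the density of the law with [e] open relative to the
   one with [e] closed is increasing, hence correlated with [g'] by induction, and opening [e]
   increases [g'] itself. *)
have ratio g' : increasing_on (e |` E) g' ->
    (\sum_(w <- fpowerset E) f (e |` w)) * (\sum_(w <- fpowerset E) f w * g' w) <=
    (\sum_(w <- fpowerset E) f w) *
      (\sum_(w <- fpowerset E) f (e |` w) * g' (e |` w)).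
  move=> g'E; have [g'0 _] := up _ g'E.
  have rE : increasing_on E (fun w => f (e |` w) / f w).
    move=> w w' ww' w'E; have wE := fsubset_trans ww' w'E.
    rewrite ler_pdivrMr ?f0' // mulrAC ler_pdivlMr ?f0' // [leRHS]mulrC.
    apply: fE; rewrite ?eS ?inE ?eqxx //; apply: contra eE; exact: (fsubsetP w'E).
  have fK w : w `<=` E -> f w * (f (e |` w) / f w) = f (e |` w).
    by move=> wE; rewrite mulrC divfK // gt_eqF ?f0'.
  have := IH f _ g' f0' fE0 rE g'0.
  under eq_fbigr => w do [rewrite fpowersetE => wE _; rewrite fK //].
  move=> /le_trans; apply; rewrite ler_pM2l ?pos //.
  rewrite big_seq_cond [leRHS]big_seq_cond; apply: ler_sum => w.
  rewrite andbT fpowersetE => wE; rewrite mulrA fK // ler_pM2l ?f1' //.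
  by apply: g'E; rewrite ?fsubsetUr ?eU.
have := IH _ _ _ f1' fE1 g1 h1; have := IH _ _ _ f0' fE0 g0 h0.
have := ratio h hE; have := ratio g gE; rewrite !sum_powersetU1 //.
set Z0 := \sum_(w <- _) f w; set Z1 := \sum_(w <- _) f (e |` w).
have Z0p : 0 < Z0 := pos _ f0'; have Z1p : 0 < Z1 := pos _ f1'.
set G0 := \sum_(w <- _) f w * g w; set G1 := \sum_(w <- _) f _ * g (_ |` _).
set H0 := \sum_(w <- _) f w * h w; set H1 := \sum_(w <- _) f _ * h (_ |` _).
set A0 := \sum_(w <- _) f w * (_ * _); set A1 := \sum_(w <- _) f _ * (_ * _).
move=> rG rH GH0 GH1; rewrite -(ler_pM2l Z0p) -(ler_pM2l Z1p) -subr_ge0.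
(* The covariance splits into a term between the two states of [e] and one term within each
   state. *)
rewrite [leRHS](_ : _ = (Z0 * G1 - Z1 * G0) * (Z0 * H1 - Z1 * H0) +
   Z0 * (Z0 + Z1) * (Z1 * A1 - G1 * H1) +
   Z1 * (Z0 + Z1) * (Z0 * A0 - G0 * H0)); last by ring.
by rewrite !addr_ge0 ?mulr_ge0 ?subr_ge0 ?addr_ge0 // ltW.
Qed.

Context (T : choiceType) (a : R) (a0 : 0 < a).
Implicit Types (w E F : {fset {fset T}}) (g : {fset {fset T}} -> R).

Lemma wt_gt0 w : 0 < wt a w.
Proof.
rewrite mulr_gt0 ?exprn_gt0 // (lt_le_trans ltr01) // gen_xpred0_ge1 //.
Qed.

Lemma sum_wt_gt0 E : 0 < \sum_(w <- fpowerset E) wt a w.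
Proof.
rewrite (big_fsetD1 fset0) ?fpowersetE ?fsub0set //=.
by rewrite ltr_pwDl ?wt_gt0 // sumr_ge0 // => w _; rewrite ltW ?wt_gt0.
Qed.

Lemma wtU1 w x y : x != y -> simple w -> [fset x; y] \notin w ->
  wt a ([fset x; y] |` w) = wt a w * (a * (1 + (conn w x y)%:R)).
Proof.
by move=> xy sw ew; rewrite /wt gen1U1 // cardfsU1 ew exprD expr1; ring.
Qed.

Lemma conn_natr_le w w' x y :
  w `<=` w' -> (conn w x y)%:R <= (conn w' x y)%:R :> R.
Proof.
move=> ww'; rewrite ler_nat.
by have := @connS _ _ _ x y ww'; case: conn => // ->.
Qed.

(** The odds of an edge are [a], or [2 * a] once its ends are connected, so they increase with the
    configuration. *)
Lemma wt_FKG E g h : simple E -> increasing_on E g -> increasing_on E h ->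
  (\sum_(w <- fpowerset E) wt a w * g w) *
    (\sum_(w <- fpowerset E) wt a w * h w) <=
  (\sum_(w <- fpowerset E) wt a w) *
    (\sum_(w <- fpowerset E) wt a w * (g w * h w)).
Proof.
move=> sE; apply: FKG => [w _|e w w' eE ww' w'E ew']; first exact: wt_gt0.
have [x [y [xy ee]]] := sE _ eE; rewrite ee in ew' *.
have wE := fsubset_trans ww' w'E.
rewrite !wtU1 //; try exact: simpleS sE; last first.
  by apply: contra ew'; exact: (fsubsetP ww').
rewrite -mulrA ler_pM2l ?wt_gt0 // mulrC ler_pM2l ?wt_gt0 // ler_pM2l // lerD2l.
exact: conn_natr_le.
Qed.

(** Edges are added one at a time. Summing over the state of the new edge [xy] tilts the law by the
    increasing factor [1 + a * (1 + conn w x y)], which FKG correlates with [g]. *)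
Lemma wt_mono E E' g : simple E' -> E `<=` E' -> increasing_on E g ->
  (\sum_(w <- fpowerset E) wt a w * g w) / (\sum_(w <- fpowerset E) wt a w) <=
  (\sum_(w <- fpowerset E') wt a w * g (w `&` E)) /
    (\sum_(w <- fpowerset E') wt a w).
Proof.
move=> sE' EE' gE; have eE' : E' = (E' `\` E) `|` E.
  by rewrite fsetUC -{1}(fsetID E E') (fsetIidPr EE').
have : [disjoint E' `\` E & E] by apply/fdisjointP => e; rewrite !inE => /andP[].
move: (E' `\` E) eE' => F0 eE'; move: sE'; rewrite {}eE' {EE'}.
elim/fset1U_rect: F0 => [|e F eF IH].
  rewrite fset0U => _ _; rewrite le_eqVlt; apply/orP; left; apply/eqP.
  congr (_ / _); apply: eq_fbigr => w.
  by rewrite fpowersetE => wE _; rewrite (fsetIidPl wE).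
rewrite -fsetUA => sE' /fdisjointP dE.
have eE : e \notin E by apply: dE; exact: fset1U1.
set F' := F `|` E in sE' *; have eF' : e \notin F' by rewrite inE negb_or eF.
have sF' : simple F' by apply: simpleS sE'; exact: fsubsetUr.
apply: le_trans (IH sF' _) _.
  by apply/fdisjointP => i iF; apply: dE; rewrite in_fset1U iF orbT.
rewrite ler_pdivrMr ?sum_wt_gt0 // mulrAC ler_pdivlMr ?sum_wt_gt0 //.
have [x [y [xy ee]]] := sE' e (fset1U1 e F').
have sumU (k : {fset {fset T}} -> R) : (forall w, k (e |` w) = k w) ->
    \sum_(w <- fpowerset (e |` F')) wt a w * k w =
    \sum_(w <- fpowerset F') wt a w * (k w * (1 + a * (1 + (conn w x y)%:R))).
  move=> kU; rewrite sum_powersetU1 // -big_split /=; apply: eq_fbigr => w.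
  rewrite fpowersetE => wF' _; rewrite kU ee wtU1 //; first by ring.
    exact: simpleS wF' sF'.
  by rewrite -ee; apply: contra eF'; exact: (fsubsetP wF').
have := sumU (fun=> 1) (fun=> erefl); under eq_bigr do rewrite mulr1.
under [in RHS]eq_bigr do rewrite mul1r.
move=> ->; rewrite sumU => [|w]; last first.
  congr g; apply/fsetP => i; rewrite !inE.
  by case: eqP => // ->; rewrite (negbTE eE) !andbF.
rewrite [leRHS]mulrC; apply: wt_FKG => // w w' ww' w'F'.
  by apply: gE; rewrite ?fsubsetIr // fsetSI.
by rewrite lerD2l ler_pM2l // lerD2l; exact: conn_natr_le.
Qed.

End FKG.

(** * Number of clusters and even subgraphs *)

Section Clusters.

(** Counting spins that are constant on clusters expresses [2 ^ k(w)] in a form that is easy to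
    follow when an edge is added. *)
Definition spins (X : finType) (r : rel X) : {set {ffun X -> bool}} :=
  [set s : {ffun X -> bool} | [forall x, forall y, r x y ==> (s x == s y)]].

Lemma spinsP (X : finType) (r : rel X) (s : {ffun X -> bool}) :
  reflect (forall x y, r x y -> s x = s y) (s \in spins r).
Proof.
rewrite inE; apply: (iffP forallP) => [h x y xy|h x].
  by have /forallP/(_ y)/implyP/(_ xy)/eqP := h x.
by apply/forallP => y; apply/implyP => /h ->.
Qed.

(** The values at the roots of the components are free and determine the others. *)
Lemma card_spins (X : finType) (r : rel X) : connect_sym r ->
  #|spins r| = (2 ^ n_comp r predT)%N.
Proof.
move=> sr; have inv (s : {ffun X -> bool}) : s \in spins r ->
    forall x, s (fingraph.root r x) = s x.
  move=> /spinsP h x; apply/esym.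
  have /connectP[p xp ->] := connect_root r x.
  by elim: p x xp => //= y p IH x /andP[/h-> /IH].
have -> : n_comp r predT = #|roots r|.
  by apply: eq_card => x; rewrite !inE andbT.
rewrite -card_bool -(card_pffun_on false (roots r) predT).
have off (f : {ffun X -> bool}) : f \in pffun_on false (roots r) predT ->
    forall x, ~~ roots r x -> f x = false.
  by move=> /pffun_onP[/supportP].
pose ext (f : {ffun X -> bool}) := [ffun x => f (fingraph.root r x)].
rewrite -[RHS](@card_in_imset _ _ ext); last first.
move=> f g /off f0 /off g0 /ffunP fg.
  apply/ffunP => x; have [/eqP xr|xr] := boolP (roots r x);
    last by rewrite f0 ?g0.
  by have := fg x; rewrite !ffunE xr.
apply: eq_card => s; apply/idP/imsetP => [sr'|[f _ ->]].
  exists [ffun x => roots r x && s x].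
    apply/pffun_onP; split => //; apply/supportP => x xr.
    by rewrite ffunE; move: xr; rewrite inE => /negbTE ->.
  by apply/ffunP => x; rewrite !ffunE roots_root // inv.
apply/spinsP => x y xy; rewrite !ffunE; congr (f _); apply/(fingraph.rootP sr).
exact: connect1.
Qed.

Context (T : choiceType) (V : {fset T}).
Implicit Types (w : {fset {fset T}}) (x y : T).

Let adjw w : rel V := fun a b => [fset val a; val b] \in w.

Let adjw_sym w : connect_sym (adjw w).
Proof. by apply: sym_connect_sym => a b; rewrite /adjw fsetUC. Qed.

Let supported w := forall e, e \in w -> e `<=` V.

Lemma spins_conn w (s : {ffun V -> bool}) (x y : V) : supported w ->
  s \in spins (adjw w) -> conn w (val x) (val y) -> s x = s y.
Proof.
move=> wV /spinsP sw xy.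
suff H z (zV : z \in V) : conn w z (val y) -> s [` zV] = s y.
  by have := H _ (valP x) xy; congr (s _ = _); exact: val_inj.
move: z zV {xy x}.
suff H x : conn w x (val y) -> forall xV : x \in V, s [` xV] = s y.
  by move=> z zV /H; apply.
move: x; apply: conn_ind => [yV|x z xz _ IH xV].
  by congr (s _); exact: val_inj.
have zV : z \in V by apply: (fsubsetP (wV _ xz)); exact: fset22.
by rewrite -(IH zV); apply: sw.
Qed.

(** The new edge imposes [s x = s y]. This is automatic if [x] and [y] are connected; otherwise
    flipping the cluster of [x] exchanges the spins that satisfy it and those that do not. *)
Lemma card_spinsU1 w (x y : V) : x != y -> simple w -> supported w ->
  [fset val x; val y] \notin w ->
  (#|spins (adjw ([fset val x; val y] |` w))| * 2 =
   #|spins (adjw w)| * (1 + conn w (val x) (val y)))%N.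
Proof.
move=> xy sw wV ew.
have spinsU s : (s \in spins (adjw ([fset val x; val y] |` w))) =
    (s \in spins (adjw w)) && (s x == s y).
  apply/spinsP/andP => [h|[/spinsP h /eqP sxy] a b].
    split; last by apply/eqP/h; rewrite /adjw !inE eqxx.
    apply/spinsP => a b ab; apply: h; rewrite /adjw in_fset1U.
    by apply/orP; right.
  rewrite /adjw in_fset1U => /orP[/eqP e|/h//].
  have ae : val a \in [fset val x; val y] by rewrite -e fset21.
  have be : val b \in [fset val x; val y] by rewrite -e fset22.
  by move: ae be; rewrite !inE => /orP[]/eqP/val_inj-> /orP[]/eqP/val_inj->.
have [c|c] := boolP (conn w (val x) (val y)).
  congr (_ * _)%N; apply: eq_card => s; rewrite spinsU; apply: andb_idr => h.
  by apply/eqP; exact: (spins_conn wV h c).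
rewrite addn0 muln1 muln2 -addnn.
pose flip (s : {ffun V -> bool}) :=
  [ffun z : V => s z (+) conn w (val x) (val z)].
have flipK : involutive flip.
  by move=> s; apply/ffunP => z; rewrite !ffunE -addbA addbb addbF.
have flipS s : s \in spins (adjw w) -> flip s \in spins (adjw w).
  move=> /spinsP h; apply/spinsP => a b ab; rewrite !ffunE (h _ _ ab).
  congr (_ (+) _).
  have ab' : conn w (val a) (val b) by exact: conn1.
  by apply/idP/idP => /conn_trans; apply; rewrite // conn_sym.
set A := spins (adjw (_ |` _)).
have -> : (#|spins (adjw w)| = #|A| + #|flip @^-1: A|)%N.
  rewrite -(cardsID A (spins (adjw w))); congr (_ + _)%N; apply: eq_card => s.
    by rewrite finset.in_setI /A spinsU; case: (s \in spins (adjw w)).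
  rewrite finset.in_setD [RHS]inE /A !spinsU !ffunE conn0 (negbTE c) addbF addbT.
  have -> : (flip s \in spins (adjw w)) = (s \in spins (adjw w)).
    by apply/idP/idP => /flipS //; rewrite flipK.
  by case: (s \in spins _) => //=; case: (s x); case: (s y).
by rewrite card_preimset //; exact: (can_inj flipK).
Qed.

(** Euler's formula: the even subgraphs form a space over the two-element field of dimension
    [|w| - |V| + k(w)]. A new edge [xy] multiplies both sides by [1 + conn w x y]. *)
Lemma exp2_n_comp (R : realFieldType) w : simple w -> supported w ->
  2 ^+ n_comp (adjw w) predT * 2 ^+ #|`w| = 2 ^+ #|`V| * gen 1 w xpred0 :> R.
Proof.
move=> sw wV; transitivity (#|spins (adjw w)|%:R * 2 ^+ #|`w| : R).
  by rewrite card_spins // natrX.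
elim/fset1U_rect: w sw wV => [|e w ew IH] sw wV.
  have -> : #|spins (adjw fset0)| = (2 ^ #|`V|)%N.
    rewrite cardfE -card_bool -card_ffun -cardsT; apply: eq_card => s.
    by rewrite finset.in_setT; apply/spinsP => x y; rewrite /adjw inE.
  rewrite cardfs0 expr0 natrX /gen big_mkcond sum_powerset0 cardfs0 expr0.
  by case: srcP => // -[] z; rewrite bd0.
have ww : w `<=` e |` w := fsubsetUr _ _.
have sw' := simpleS ww sw; have wV' : supported w by move=> f /(fsubsetP ww)/wV.
have [a [b [ab ee]]] := sw e (fset1U1 e w).
have /fsubsetP eV := wV e (fset1U1 e w).
have aV : a \in V by apply: eV; rewrite ee fset21.
have bV : b \in V by apply: eV; rewrite ee fset22.
rewrite {}ee in ew *; rewrite gen1U1 // mulrA -IH // cardfsU1 ew exprD expr1.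
have /(congr1 (fun n => n%:R : R)) := @card_spinsU1 w [` aV] [` bV] ab sw' wV' ew.
by rewrite !natrM natrD /= mulrA => ->; ring.
Qed.

End Clusters.

Import classical_sets.

(** * The FK model in finite volume *)

(** The left side is [tanh b]. *)
Lemma expR_tanh_le (R : realType) (b : R) : 0 <= b ->
  (expR (2 * b) - 1) / 2 / (1 + (expR (2 * b) - 1) / 2) <= b.
Proof.
rewrite le_eqVlt => /orP[/eqP<-|b0]; first by rewrite mulr0 expR0 subrr !mul0r.
set e := expR (2 * b).
have e1 : 1 <= e by rewrite -expR0 ler_expR mulr_ge0 // ltW.
suff : 2 * (e - 1) <= (2 * b) * (e + 1).
  by move=> h; rewrite ler_pdivrMr; lra.
(* At [2 * b], [f] is the difference of the two sides, and it vanishes at 0. *)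
pose f (x : R) : R := x * (expR x + 1) - 2 * (expR x - 1).
pose df (x : R) : R := 1 + (x - 1) * expR x.
have fD x : is_derive x (1 : R) f (df x).
  by apply: is_derive_eq; rewrite /GRing.scale /= /df; ring.
have [||c] := @MVT R f df 0 (2 * b) _ (fun x _ => fD x).
- by rewrite mulr_gt0.
- apply: continuous_subspaceT => x.
  by apply/differentiable_continuous/derivable1_diffP; have [] := fD x.
rewrite {1 2}/f expR0 subrr mulr0 mul0r subrr !subr0 => _ h.
(* Multiplied by [expR (- c)], this reads [1 - c <= expR (- c)]. *)
have df0 : 0 <= df c.
  rewrite /df -(pmulr_lge0 _ (expR_gt0 (- c))) mulrDl mul1r -mulrA -expRD subrr.
  by rewrite expR0 mulr1; have := expR_ge1Dx (- c); lra.
by rewrite -subr_ge0 h mulr_ge0 // mulr_ge0 // ltW.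
Qed.

Section FiniteVolume.
Context (R : realType) (d : nat).
Implicit Types (G : subgraph d) (x y u v : vertex d) (w : {fset edge d}).
Implicit Types (S B L : set (vertex d)) (beta : {nonneg R}).

Lemma adj_sym x y : adj x y = adj y x.
Proof.
by rewrite /adj; congr (_ == _); apply: eq_bigr => i _; rewrite -sqrrN opprB.
Qed.

Lemma adj_neq x y : adj x y -> x != y.
Proof.
apply: contraTneq => ->; rewrite /adj big1 // => i _.
by rewrite subrr expr0n.
Qed.

Lemma edges_of_adj L x y : edges_of L [fset x; y] -> [/\ L x, L y & adj x y].
Proof.
move=> [a [b [La Lb ab /fsetP e]]].
have xe : x \in [fset a; b] by rewrite -e fset21.
have ye : y \in [fset a; b] by rewrite -e fset22.
have ae : a \in [fset x; y] by rewrite e fset21.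
have be : b \in [fset x; y] by rewrite e fset22.
have := adj_neq ab; move: xe ye ae be ab; rewrite !inE.
move=> /orP[]/eqP-> /orP[]/eqP->; rewrite ?orbb => //.
- by move=> _ /eqP->; rewrite eqxx.
- by rewrite adj_sym.
- by move=> /eqP-> _; rewrite eqxx.
Qed.

Lemma finite_edges_of L : finite_set L -> finite_set (edges_of L).
Proof.
move=> fL; apply: (@sub_finite_set _ _
  [set [fset x; y] | x in L & y in L]%classic).
  by move=> _ [x [y [Lx Ly _ ->]]]; exists x => //; exists y.
exact: finite_image2.
Qed.

Lemma finite_gE G : finite_set (gV G) -> finite_set (gE G).
Proof.
by move=> fG; exact: sub_finite_set (@gE_sub _ G) (finite_edges_of fG).
Qed.

Lemma in_finV G x : finite_set (gV G) -> (x \in finV G) = (x \in gV G).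
Proof. by move=> fG; rewrite in_fset_set. Qed.

Lemma in_finE G e : finite_set (gV G) -> (e \in finE G) = (e \in gE G).
Proof. by move=> fG; rewrite in_fset_set //; exact: finite_gE. Qed.

Lemma edge_finE G x y : finite_set (gV G) -> [fset x; y] \in finE G ->
  [/\ x \in finV G, y \in finV G & adj x y].
Proof.
move=> fG; rewrite in_finE // inE => /gE_sub/edges_of_adj[Lx Ly xy].
by rewrite !in_finV // !inE.
Qed.

Lemma simple_finE G : finite_set (gV G) -> simple (finE G).
Proof.
move=> fG e; rewrite in_finE // inE => /gE_sub[x [y [_ _ /adj_neq xy ->]]].
by exists x, y.
Qed.

Lemma finE_finV G e : finite_set (gV G) -> e \in finE G -> e `<=` finV G.
Proof.
move=> fG eE; have [x [y [_ e_]]] := simple_finE fG eE; move: eE; rewrite {}e_.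
by move=> /(edge_finE fG)[xV yV _]; rewrite fsubUset !fsub1set xV.
Qed.

(** The parameter [a] of [wt]: the FK edge weight is halved because of the [2 ^ #|w|] in Euler's
    formula. *)
Definition odds beta : R := (expR (2 * beta%:num) - 1) / 2.

Lemma odds_ge0 beta : 0 <= odds beta.
Proof. by rewrite divr_ge0 // subr_ge0 -expR0 ler_expR mulr_ge0. Qed.

Lemma odds_gt0 beta : 0 < beta%:num -> 0 < odds beta.
Proof. by move=> b0; rewrite divr_gt0 // subr_gt0 -expR0 ltr_expR mulr_gt0. Qed.

Lemma fk_weightE G beta w : finite_set (gV G) -> w `<=` finE G ->
  fk_weight G beta w = 2 ^+ #|`finV G| * wt (odds beta) w.
Proof.
move=> fG wE; rewrite /fk_weight /wt.
have -> : \prod_(e <- finE G) (expR (2 * beta%:num) - 1) ^+ (e \in w) =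
    (2 * odds beta) ^+ #|`w|.
  rewrite -(big_fset_incl _ wE) /= => [|e _ /negbTE->]; last by rewrite expr0.
  rewrite (eq_fbigr _ (G := fun=> 2 * odds beta)) => [|e ew _].
    by rewrite big_const_seq count_predT iter_mulr_1.
  by rewrite ew expr1 /odds; field.
have sw := simpleS wE (simple_finE fG).
have wV e : e \in w -> e `<=` finV G by move=> /(fsubsetP wE); exact: finE_finV.
have h : 2 ^+ n_clusters G w * 2 ^+ #|`w| = 2 ^+ #|`finV G| * gen 1 w xpred0 :> R.
  exact: exp2_n_comp.
by rewrite exprMn [LHS]mulrA h -mulrA [gen _ _ _ * _]mulrC.
Qed.

Lemma fk_finiteE G beta (A : set (borel_config d)) : finite_set (gV G) ->
  fk_finite G beta A =
  ((\sum_(w <- fpowerset (finE G))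
      wt (odds beta) w * ((config_of w : borel_config d) \in A)%:R) /
   (\sum_(w <- fpowerset (finE G)) wt (odds beta) w))%:E.
Proof.
move=> fG; set Z := \sum_(w <- _) wt _ _.
have ZE : fk_partition G beta = 2 ^+ #|`finV G| * Z.
  rewrite /fk_partition mulr_sumr; apply: eq_fbigr => w.
  by rewrite fpowersetE => wE _; exact: fk_weightE.
rewrite /fk_finite mulr_suml -sumEFin; apply: eq_fbigr => w.
rewrite fpowersetE => wE _; rewrite diracE -EFinM fk_weightE // ZE.
by congr (_%:E); rewrite -mulf_div divff ?mul1r ?expf_neq0 //; rewrite mulrAC.
Qed.

Lemma conn_finV G w x y : finite_set (gV G) -> w `<=` finE G -> conn w x y ->
  (x \in finV G) = (y \in finV G).
Proof.
move=> fG /fsubsetP wE; move: x; apply: conn_ind => [//|x z xz _ <-].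
by have [-> -> _] := edge_finE fG (wE _ xz).
Qed.

(** The target is cut down to the vertices of [G] because [conn], unlike [connected_to], links a
    point outside [G] to itself. *)
Lemma connected_toE G w x B : finite_set (gV G) -> finite_set B ->
  w `<=` finE G ->
  ((config_of w : borel_config d) \in connected_to G x B) =
  hit w x (fset_set B `&` finV G).
Proof.
move=> fG fB wE; apply/idP/hitP => [|[y]].
  rewrite inE => -[Vx [p [xp Bp]]].
  have xy : conn w x (last x p).
    apply/connP; exists p => //; apply: sub_path xp => a b /andP[_ +].
    by rewrite /config_of.
  exists (last x p) => //; rewrite inE in_fset_set // mem_set //=.
  by rewrite -(conn_finV fG wE xy) in_finV // mem_set.
rewrite inE in_fset_set // => /andP[yB yV] xy; rewrite inE; split.
  by move: yV; rewrite -(conn_finV fG wE xy) in_finV // inE.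
move: xy => /connP[p xp yp]; exists p; split; last by rewrite yp; apply/set_mem.
apply: sub_path xp => a b ab; rewrite /config_of ab andbT /graph_adj.
by rewrite -in_finE //; exact: (fsubsetP wE).
Qed.

Lemma fk_connected_to G beta x B : finite_set (gV G) -> finite_set B ->
  fk_finite G beta (connected_to G x B) =
  (hit_weight (odds beta) (finE G) x (fset_set B `&` finV G) /
   (\sum_(w <- fpowerset (finE G)) wt (odds beta) w))%:E.
Proof.
move=> fG fB; rewrite fk_finiteE //; congr (_ / _)%:E.
rewrite /hit_weight [RHS]big_mkcond /=; apply: eq_fbigr => w.
rewrite fpowersetE => wE _; rewrite connected_toE //.
by case: hit; rewrite ?mulr1 ?mulr0.
Qed.

Lemma fk_two_point G beta x y : finite_set (gV G) -> gV G y ->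
  fk_finite G beta (connected_to G x [set y]%classic) =
  (gen (odds beta / (1 + odds beta)) (finE G) (pair x y) /
   gen (odds beta / (1 + odds beta)) (finE G) xpred0)%:E.
Proof.
move=> fG Vy; rewrite fk_connected_to ?finite_set1 //.
have -> : fset_set [set y]%classic `&` finV G = [fset y].
  by rewrite fset_set1; apply/fsetIidPl; rewrite fsub1set in_finV // mem_set.
rewrite hit_weight1 ?odds_ge0 //; last exact: simple_finE.
rewrite /wt sum_gen1 ?odds_ge0 // -mulf_div divff ?mul1r // expf_neq0 //.
by rewrite gt_eqF // ltr_pwDl ?odds_ge0.
Qed.

Lemma finite_adj x : finite_set [set y | adj x y]%classic.
Proof.
(* Coordinates of neighbours differ by -1, 0 or 1, coded as a difference of two booleans. *)
pose f (r : 'rV[bool * bool]_d) : vertex d :=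
  map_mx (fun p : bool * bool => (nat_of_bool p.1)%:Z - (nat_of_bool p.2)%:Z) r.
apply: (@sub_finite_set _ _ ((fun r => x - f r) @` setT)%classic); last first.
  exact/finite_image/finite_finset.
move=> y /= xy; exists (\row_i (x 0 i - y 0 i == 1, x 0 i - y 0 i == -1)) => //.
apply/rowP => i; rewrite !mxE /=.
suff : (x 0 i - y 0 i) ^+ 2 <= 1.
  move=> z1; apply/eqP; rewrite subr_eq addrC -subr_eq; apply/eqP.
  move: (x 0 i - y 0 i) z1 => z z1.
  by have [->|[->|->]] : z = 0 \/ z = 1 \/ z = -1 by nia.
have /eqP <- : adj x y := xy.
by rewrite (bigD1 i) //= lerDl sumr_ge0 // => j _; rewrite sqr_ge0.
Qed.

End FiniteVolume.

(** * The inequality for finite graphs *)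

Section FiniteInequality.
Context (R : realType) (d : nat) (beta : {nonneg R}).
Implicit Types (G H : subgraph d) (x y u v : vertex d) (S B : set (vertex d)).

Definition crossing S : set (vertex d * vertex d) :=
  [set uv | [/\ S uv.1, ~ S uv.2 & adj uv.1 uv.2]]%classic.

Lemma finite_crossing S : finite_set S -> finite_set (crossing S).
Proof.
move=> fS; apply: (@sub_finite_set _ _
  (\bigcup_(u in S) ((fun v => (u, v)) @` [set v | adj u v]))%classic).
  by move=> [u v] /= [Su _ uv]; exists u => //; exists v.
by apply: bigcup_finite => // u _; exact/finite_image/finite_adj.
Qed.

Lemma fk_inequality_finite G S B : finite_set (gV G) -> finite_set S ->
  finite_set B -> (S `&` B = set0)%classic -> S 0 ->
  (fk_finite G beta (connected_to G 0 B) <=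
   \sum_(uv <- fset_set (crossing S))
     fk_finite (induced_subgraph S) beta
       (connected_to (induced_subgraph S) 0 [set uv.1]%classic) *
     (beta%:num)%:E * fk_finite G beta (connected_to G uv.2 B))%E.
Proof.
move=> fG fS fB SB S0; pose a := odds beta; pose t := a / (1 + a).
have a0 : 0 <= a := odds_ge0 beta.
have t0 : 0 <= t by rewrite divr_ge0 // addr_ge0.
have tb : t <= beta%:num by exact: expR_tanh_le.
pose E' := finE (induced_subgraph S).
pose r u := gen t E' (pair 0 u) / gen t E' xpred0.
have r0 u : 0 <= r u by rewrite divr_ge0 ?gen_ge0.
pose B' := fset_set B `&` finV G.
pose Z := \sum_(w <- fpowerset (finE G)) wt a w.
have Z0 : 0 <= Z by rewrite sumr_ge0 // => w _; exact: wt_ge0.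
have inS x : (x \in fset_set S) = (x \in S) by rewrite in_fset_set.
suff : hit_weight a (finE G) 0 B' / Z <= \sum_(uv <- fset_set (crossing S))
    r uv.1 * beta%:num * (hit_weight a (finE G) uv.2 B' / Z).
  rewrite fk_connected_to // -lee_fin => /le_trans; apply.
  rewrite -sumEFin le_eqVlt; apply/orP; left; apply/eqP.
  apply: eq_fbigr => -[u v]; rewrite in_fset_set; last exact: finite_crossing.
  rewrite inE => -[/= Su _ _] _.
  by rewrite fk_two_point // fk_connected_to // !EFinM.
(* This is [simon_lieb_hit] before normalisation; [t = tanh beta] is then bounded by [beta]. *)
have le1 : hit_weight a (finE G) 0 B' <= \sum_(uv <- fset_set (crossing S))
    r uv.1 * t * hit_weight a (finE G) uv.2 B'.
  apply: (@simon_lieb_hit _ _ a _ E' (fset_set S)) => //.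
  - exact: simple_finE.
  - by move=> e eE; have := @finE_finV _ (induced_subgraph S) e fS eE.
  - move=> e eE /fsubsetP eS; have [x [y [_ exy]]] := simple_finE fG eE.
    rewrite in_finE // inE /=; exists x, y; rewrite exy in eE eS *.
    have [_ _ xy] := edge_finE fG eE.
    split=> //; apply/set_mem; rewrite -inS; apply: eS;
      by rewrite ?fset21 ?fset22.
  - by rewrite inS mem_set.
  - apply/fdisjointP => x; rewrite inS inE => Sx; rewrite !inE in_fset_set //.
    apply/negP => /andP[/set_mem Bx _].
    by have : (S `&` B)%classic x by []; rewrite SB.
  - move=> u v; rewrite !inS inE => Su nSv /(edge_finE fG)[_ _ uv].
    rewrite in_fset_set; last exact: finite_crossing.
    by rewrite inE; split=> //= Sv; case/negP: nSv; rewrite inE.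
under eq_bigr do rewrite mulrA.
rewrite -mulr_suml ler_wpM2r ?invr_ge0 //; apply: le_trans le1 _.
apply: ler_sum => uv _; rewrite ler_wpM2r ?hit_weight_ge0 //.
by rewrite ler_wpM2l.
Qed.

Lemma connected_to_local G x B (w w' : config d) :
  (forall e, gE G e -> w e -> w' e) ->
  connected_to G x B w -> connected_to G x B w'.
Proof.
move=> ww' [Vx [p [xp Bp]]]; split => //; exists p; split => //.
apply: sub_path xp => a b /andP[ab wab]; rewrite ab /=.
by apply: ww' wab; apply/set_mem.
Qed.

Lemma connected_to_sub G H x B : (gV H `<=` gV G)%classic ->
  (gE H `<=` gE G)%classic ->
  (connected_to H x B `<=` connected_to G x B)%classic.
Proof.
move=> VHG EHG w [Vx [p [xp Bp]]]; split; first exact: VHG.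
exists p; split => //; apply: sub_path xp => a b /andP[ab ->].
by rewrite andbT /graph_adj mem_set //; apply/EHG/set_mem.
Qed.

(** The event is that of [H] on both sides; only the law changes, so [wt_mono] applies to its
    indicator. *)
Lemma fk_finite_mono G H x B : 0 < beta%:num -> finite_set (gV G) ->
  (gV H `<=` gV G)%classic -> (gE H `<=` gE G)%classic -> finite_set B ->
  (fk_finite H beta (connected_to H x B) <=
   fk_finite G beta (connected_to H x B))%E.
Proof.
move=> b0 fG VHG EHG fB; have fH := sub_finite_set VHG fG.
rewrite !fk_finiteE // lee_fin.
pose g w : R := ((config_of w : borel_config d) \in connected_to H x B)%:R.
have EHG' : finE H `<=` finE G.
  by apply/fsubsetP => e; rewrite !in_finE // !inE; exact: EHG.
apply: (le_trans (wt_mono (g := g) (odds_gt0 b0) (simple_finE fG) EHG' _)).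
  move=> w w' /fsubsetP ww' _; rewrite /g ler_nat.
  case: (boolP (_ \in _)) => // /set_mem h; rewrite mem_set //.
  by apply: connected_to_local h => e _; exact: ww'.
rewrite ler_wpM2r ?invr_ge0 ?sumr_ge0 // => [w _|].
  by rewrite wt_ge0 ?odds_ge0.
apply: ler_sum => w _; rewrite ler_wpM2l ?wt_ge0 ?odds_ge0 // ler_nat.
case: (boolP (_ \in _)) => // /set_mem h; rewrite mem_set //.
by apply: connected_to_local h => e _; rewrite /config_of inE => /andP[].
Qed.

End FiniteInequality.

(** * Infinite volume *)

Section InfiniteVolume.
Local Open Scope classical_set_scope.
Context (R : realType) (d : nat).
Implicit Types (G : subgraph d) (x : vertex d) (B : set (vertex d)).
Implicit Types (A : set (config d)).

Lemma near_config (s : seq (edge d)) (w : config d) :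
  \forall w' \near w, {in s, forall e, (w' : config d) e = w e}.
Proof.
elim: s => [|e s IH]; first by near=> w' => e.
have we : \forall w' \near w, (w' : config d) e = w e.
  exact: (@proj_continuous (edge d) (fun=> bool) e w _ (discrete_set1 (w e))).
near=> w' => f; rewrite inE => /orP[/eqP->|fs]; first by near: w'.
have ws : {in s, forall e, (w' : config d) e = w e} by near: w'.
exact: ws.
Unshelve. all: by end_near.
Qed.

(** Such events are open and closed, so weak convergence passes to their probabilities. *)
Definition cylinder (E : {fset edge d}) A :=
  forall w w' : config d, {in E, w =1 w'} -> A w -> A w'.

Lemma cylinder_open E A : cylinder E A -> open A.
Proof.
move=> EA; rewrite openE => w Aw; rewrite /interior.
by apply: filterS (near_config (enum_fset E) w) => w' ww'; apply: EA Aw => e /ww'.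
Qed.

Lemma cylinder_measurable E A :
  cylinder E A -> measurable (A : set (borel_config d)).
Proof. by move=> /cylinder_open oA; exact: sub_sigma_algebra. Qed.

Lemma cylinder_indic_continuous E A : cylinder E A ->
  continuous (\1_A : config d -> R).
Proof.
move=> EA w; apply: cvg_near_cst.
apply: filterS (near_config (enum_fset E) w) => w' ww'.
rewrite !indicE; congr (_%:R); congr nat_of_bool; apply/idP/idP => /set_mem h;
  by apply/mem_set; apply: EA h => e /ww'.
Qed.

Lemma weak_cvg_cylinder (P_ : nat -> probability (borel_config d) R)
    (P : probability (borel_config d) R) E A :
  weak_cvg P_ P -> cylinder E A ->
  (fun n => fine (P_ n A)) @ \oo --> fine (P A).
Proof.
move=> PP EA; have mA := cylinder_measurable EA.
have intE (Q : probability (borel_config d) R) :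
    (\int[Q]_w (\1_A w : R) = fine (Q A))%R.
  by rewrite /Rintegral integral_indic // setIT.
have -> : (fun n => fine (P_ n A)) = (fun n => \int[P_ n]_w (\1_A w : R))%R.
  by apply/funext => n; rewrite intE.
rewrite -intE; apply: PP (cylinder_indic_continuous EA) _.
exists 1; split => // r r1 w _ /=; rewrite indicE.
by apply: le_trans (ltW r1); case: (_ \in _); rewrite ?normr1 ?normr0.
Qed.

Lemma connected_to_cylinder G x B : finite_set (gV G) ->
  cylinder (finE G) (connected_to G x B).
Proof.
move=> fG w w' ww'; apply: connected_to_local => e eG; rewrite ww' //.
by rewrite in_finE // mem_set.
Qed.

(** * Limits along an exhaustion *)

Section Exhaustion.
Context (H : nat -> subgraph d) (G : subgraph d).
Hypothesis HG : exhaustion H G.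

Lemma exhaustion_finite n : finite_set (gV (H n)).
Proof. by case: HG. Qed.

Lemma exhaustion_le m n : (m <= n)%N ->
  gV (H m) `<=` gV (H n) /\ gE (H m) `<=` gE (H n).
Proof.
have [_ Hs _ _] := HG.
elim: n => [|n IH]; first by rewrite leqn0 => /eqP->; split.
rewrite leq_eqVlt => /predU1P[->|/IH[V E]]; first by split.
have [V' E'] := Hs n.
by split; [exact: subset_trans V V'|exact: subset_trans E E'].
Qed.

Lemma exhaustion_sub n : gV (H n) `<=` gV G /\ gE (H n) `<=` gE G.
Proof. by have [_ _ <- <-] := HG; split => x Hx; exists n. Qed.

(** A path is finite, hence contained in some [H n]. *)
Lemma connected_to_bigcup x B :
  connected_to G x B = \bigcup_n connected_to (H n) x B.
Proof.
apply/seteqP; split => [w [Vx [p [xp Bp]]]|w [n _]]; last first.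
  by have [V E] := exhaustion_sub n; exact: connected_to_sub.
(* An empty path has no edge, so a graph containing [x] is chosen separately. *)
have [n0 Hn0] : exists n, gV (H n) x.
  by move: Vx; have [_ _ <- _] := HG; move=> [n _ Vx]; exists n.
have [m Hm] : exists m, forall n, (m <= n)%N ->
    path (fun a b => graph_adj (H n) a b && w [fset a; b]%fset) x p.
  elim: p x xp {Vx n0 Hn0 Bp} => [|y p IH] x /=; first by exists 0%N.
  move=> /andP[/andP[/set_mem xy wxy] /IH[m Hm]].
  move: xy; have [_ _ _ <-] := HG; move=> [k _ Hk]; exists (maxn m k) => n.
  rewrite geq_max => /andP[mn kn]; rewrite wxy Hm // !andbT.
  by apply/mem_set; apply: (exhaustion_le kn).2.
exists (maxn m n0) => //; split; last by exists p; split; rewrite ?Hm ?leq_maxl.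
exact: (exhaustion_le (leq_maxr m n0)).1.
Qed.

Lemma connected_to_measurable x B : measurable (connected_to G x B).
Proof.
rewrite connected_to_bigcup; apply: bigcup_measurable => n _.
exact: cylinder_measurable (connected_to_cylinder (exhaustion_finite n)).
Qed.

Context (beta : {nonneg R}) (P : probability (borel_config d) R).
Hypothesis (b0 : 0 < beta%:num) (HP : weak_cvg (fun n => fk_finite (H n) beta) P).

Let P_ n : probability (borel_config d) R := fk_finite (H n) beta.

(** With the event of [H n] fixed, its probability under the law of [H k], for [k >= n], is at least
    that under the law of [H n]. Weak convergence gives the same for [P], and the event implies that
    of [G]. *)
Lemma fk_finite_le_limit n x B : finite_set B ->
  (fk_finite (H n) beta (connected_to (H n) x B) <= P (connected_to G x B))%E.
Proof.
move=> fB; have mn := cylinder_measurable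
  (connected_to_cylinder (B := B) (x := x) (exhaustion_finite n)).
have [VG EG] := exhaustion_sub n.
apply: (@le_trans _ _ (P (connected_to (H n) x B))); last first.
  apply: le_measure; rewrite ?inE //; first exact: connected_to_measurable.
  exact: connected_to_sub.
rewrite -[leLHS]fineK ?fin_num_measure //.
rewrite -[leRHS]fineK ?fin_num_measure // lee_fin.
apply: (cvgr_to_ge (weak_cvg_cylinder HP
  (connected_to_cylinder (B := B) (x := x) (exhaustion_finite n)))).
exists n => // k /= nk; have [V E] := exhaustion_le nk.
rewrite fine_le ?fin_num_measure //; apply: fk_finite_mono => //.
exact: exhaustion_finite.
Qed.

(** For [m <= n], the event of [H m] implies that of [H n], so its probability under the law of
    [H n] is at most [c]. First [n], then [m], tends to infinity. *)
Lemma limit_le x B (c : \bar R) :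
  (forall n, fk_finite (H n) beta (connected_to (H n) x B) <= c)%E ->
  (P (connected_to G x B) <= c)%E.
Proof.
move=> Hc.
have cyl n := connected_to_cylinder (B := B) (x := x) (exhaustion_finite n).
have mH n := cylinder_measurable (cyl n).
have ndH : nondecreasing_seq
    (fun n => connected_to (H n) x B : set (borel_config d)).
  by move=> m n /exhaustion_le[V E]; apply/subsetPset; exact: connected_to_sub.
have := @nondecreasing_cvg_mu _ _ _ P _ mH
  (bigcup_measurable (fun n _ => mH n)) ndH.
rewrite -connected_to_bigcup => /cvge_to_le; apply.
near=> m; rewrite /= -[leLHS]fineK ?fin_num_measure //.
case: c Hc => [c| |] Hc; last 1 first.
(* The value [-oo] is excluded since probabilities are finite. *)
- have := Hc 0%N; rewrite leeNy_eq => /eqP e.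
  have : fk_finite (H 0%N) beta (connected_to (H 0%N) x B) \is a fin_num :=
    fin_num_measure (P_ 0%N) _ (mH 0%N).
  by rewrite e.
- rewrite lee_fin; apply: (cvgr_to_le (weak_cvg_cylinder HP (cyl m))).
  exists m => // n /= mn; have [V E] := exhaustion_le mn.
  rewrite -lee_fin fineK ?fin_num_measure //; apply: le_trans (Hc n).
  apply: le_measure; rewrite ?inE //; exact: connected_to_sub.
- by rewrite leey.
Unshelve. all: by end_near.
Qed.

End Exhaustion.
End InfiniteVolume.

(* The inequality in finite and infinite volume *)
Local Close Scope fset_scope.
Local Open Scope classical_set_scope.

Theorem proposition2p13 (R : realType) (d : nat) (beta : {nonneg R})
    (G : subgraph d) (S B : set (vertex d))
    (phiG : probability (borel_config d) R) :
  (2 <= d)%N -> 0 < beta%:num ->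
  gV G 0 ->
  finite_set S -> finite_set B -> S `<=` gV G -> B `<=` gV G ->
  S `&` B = set0 -> S 0 ->
  separates G (boundary S) 0 B ->
  is_fk_free G beta phiG ->
  (phiG (connected_to G 0 B) <=
   \sum_(uv \in [set uv : vertex d * vertex d |
                   [/\ S uv.1, ~ S uv.2 & adj uv.1 uv.2]])
     fk_finite (induced_subgraph S) beta (connected_to (induced_subgraph S) 0 [set uv.1]) *
     (beta%:num)%:E * phiG (connected_to G uv.2 B))%E.
Proof.
move=> _ b0 _ fS fB _ _ SB S0 _ [phi_fin phi_inf].
rewrite fsbig_finite; last exact: (finite_crossing fS).
have [fG|/phi_inf[H HG wH]] := pselect (finite_set (gV G)).
  have phiE x : phiG (connected_to G x B) = fk_finite G beta (connected_to G x B).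
    by rewrite phi_fin //; exact: cylinder_measurable (connected_to_cylinder fG).
  rewrite phiE; apply: le_trans (fk_inequality_finite beta fG fS fB SB S0) _.
  by apply: lee_sum => uv _; rewrite phiE.
(* It suffices to bound the left side in each [H n]: the finite inequality does so, and each
   probability on its right is at most its limit in [G]. *)
apply: (limit_le HG wH) => n.
apply: le_trans
  (fk_inequality_finite beta (exhaustion_finite HG n) fS fB SB S0) _.
apply: lee_sum => uv _; apply: lee_wpmul2l.
  by rewrite mule_ge0 // lee_fin.
exact: (fk_finite_le_limit HG b0 wH n uv.2 fB).
Qed.
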